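(* Let $T$ be a complete first-order theory with monster model $\mathcal M$ and let $\boldsymbol e=a/E$ be a hyperimaginary. The following are equivalent. (1) $T$ is G-compact over $\boldsymbol e$. (2) For any hyperimaginary $b_F$, there is a partial type $\Psi(x)$ (over $ab$) such that $c\models\Psi(x)$ iff $c_F\equiv^{\operatorname L}_{\boldsymbol e}b_F$. (3) For any hyperimaginary $b_F$, there is $n<\omega$ such that for any $c_F\equiv^{\operatorname L}_{\boldsymbol e}b_F$, we have $d_{\boldsymbol e}(b_F,c_F)\le n$. (4) There is a uniform $n<\omega$ such that for every pair of hyperimaginaries $b_F$ and $c_F$, $b_F\equiv^{\operatorname L}_{\boldsymbol e}c_F$ iff $d_{\boldsymbol e}(b_F,c_F)\le n$.
   Context: Conventions: $\mathcal M$ is a ($\bar\kappa$-saturated) monster model of $T$; small means of cardinality $<\bar\kappa$; real tuples are sequences from $\mathcal M$ of small length. A hyperimaginary $b_F=b/F$ is the class of a real tuple $b$ modulo an $\emptyset$-type-definable equivalence relation $F$. $E$ is an $\emptyset$-type-definable equivalence relation, $a$ a real tuple, $\boldsymbol e=a/E$. $\operatorname{Aut}_{\boldsymbol e}(\mathcal M)=\{f\in\operatorname{Aut}(\mathcal M): f(\boldsymbol e)=\boldsymbol e\}$. $\operatorname{Autf}_{\boldsymbol e}(\mathcal M)$ is the (normal) subgroup of $\operatorname{Aut}_{\boldsymbol e}(\mathcal M)$ generated by all $f\in\operatorname{Aut}_{\boldsymbol e}(\mathcal M)$ fixing pointwise some small model $M\prec\mathcal M$ with $\boldsymbol e\in\operatorname{dcl}(M)$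 (i.e. $\boldsymbol e$ is fixed by all automorphisms fixing $M$ pointwise). $b_F\equiv^{\operatorname L}_{\boldsymbol e}c_F$ iff there is $f\in\operatorname{Autf}_{\boldsymbol e}(\mathcal M)$ with $f(b_F)=c_F$. $\operatorname{Gal}_{\operatorname L}(T,\boldsymbol e)=\operatorname{Aut}_{\boldsymbol e}(\mathcal M)/\operatorname{Autf}_{\boldsymbol e}(\mathcal M)$ with projection $\pi$. Topology: for small models $M,N$ with $\boldsymbol e\in\operatorname{dcl}(M)$, $\boldsymbol e\in\operatorname{dcl}(N)$, $S_M(N)=\{\operatorname{tp}(f(M)/N): f\in\operatorname{Aut}_{\boldsymbol e}(\mathcal M)\}$ has the relative Stone topology, and $\operatorname{Gal}_{\operatorname L}(T,\boldsymbol e)$ has the quotient topology under the well-defined map $\operatorname{tp}(f(M)/N)\mapsto\pi(f)$ (independent of $M,N$). $T$ is G-compact over $\boldsymbol e$ if the trivial subgroup is closed in $\operatorname{Gal}_{\operatorname L}(T,\boldsymbol e)$. A sequence of hyperimaginaries $(b_i/F\mid i<\omega)$ is $\boldsymbol e$-indiscernible if for every $n$ and all $i_0<\dots<i_n$, some $f\in\operatorname{Aut}_{\boldsymbol e}(\mathcal M)$ maps $(b_0/F,\dots,b_n/F)$ to $(b_{i_0}/F,\dots,b_{i_n}/F)$. The Lascar distance satisfies $d_{\boldsymbol e}(b_F,d_F)\le n$ if there are real tuples $b=b_0,b_1,\dots,b_n=d$ such that for each $i<n$, $b_i/F,b_{i+1}/F$ are the first two terms of an $\boldsymbol e$-indiscernible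 sequence. *)

(* Defs.v *)
From HB Require Import structures.
From mathcomp Require Import all_boot.
From mathcomp Require Import all_classical topology.

Set Implicit Arguments.
Unset Strict Implicit.
Unset Printing Implicit Defensive.

Local Open Scope classical_set_scope.
Local Open Scope card_scope.

(** * First-order logic *)

Record language := Language {
  fsym : Type;
  farity : fsym -> nat;
  rsym : Type;
  rarity : rsym -> nat }.

Record structure (L : language) := Structure {
  carrier :> Type;
  carrier_nonempty : inhabited carrier;
  fun_interp : forall f : fsym L, ('I_(farity f) -> carrier) -> carrier;
  rel_interp : forall r : rsym L, ('I_(rarity r) -> carrier) -> Prop }.

Arguments fun_interp {L s} f v.
Arguments rel_interp {L s} r v.

Inductive term (L : language) (V : Type) : Type :=
  | Var of V
  | App (f : fsym L) of ('I_(farity f) -> term L V).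

(* The free variables of a formula are indexed by an arbitrary type [V]; in
   [All phi] the bound variable is [None].  The logic is classical, so the
   other connectives and [exists] are definable from these. *)
Inductive formula (L : language) (V : Type) : Type :=
  | Bot
  | Eq of term L V & term L V
  | Rel (r : rsym L) of ('I_(rarity r) -> term L V)
  | Imp of formula L V & formula L V
  | All of formula L (option V).

Arguments Bot {L V}.

Definition Neg L V (phi : formula L V) : formula L V := Imp phi Bot.

Definition sentence L := formula L Empty_set.

Fixpoint eval L (M : structure L) V (v : V -> M) (t : term L V) : M :=
  match t with
  | Var x => v x
  | App f ts => fun_interp f (fun i => eval v (ts i))
  end.

Fixpoint sat L (M : structure L) V (v : V -> M) (phi : formula L V) : Prop :=
  match phi with
  | Bot => False
  | Eq t u => eval v t = eval v u
  | Rel r ts => rel_interp r (fun i => eval v (ts i))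
  | Imp phi psi => sat v phi -> sat v psi
  | All phi => forall x : M, sat (oapp v x) phi
  end.

(* The complete type of a tuple [v] over the empty set. *)
Definition tp L (M : structure L) V (v : V -> M) : set (formula L V) :=
  [set phi | sat v phi].

Definition realizes L (M : structure L) V (v : V -> M)
    (p : set (formula L V)) : Prop :=
  forall phi, p phi -> sat v phi.

Definition model_of L (T : set (sentence L)) (N : structure L) : Prop :=
  forall phi, T phi -> sat (of_void N : Empty_set -> N) phi.

Definition entails L (T : set (sentence L)) (phi : sentence L) : Prop :=
  forall N : structure L, model_of T N -> sat (of_void N : Empty_set -> N) phi.

Definition complete_theory L (T : set (sentence L)) : Prop :=
  (exists N : structure L, model_of T N) /\
  (forall phi, entails T phi \/ entails T (Neg phi)).

(* Concatenation of tuples.  A formula over [V + P] evaluated at [tcat x c] is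
   a formula in the variables [V] with parameters from the tuple [c]. *)
Definition tcat (X V P : Type) (x : V -> X) (c : P -> X) (i : V + P) : X :=
  match i with inl j => x j | inr k => c k end.

(* The type tp(b/A), with the set [A] enumerating itself. *)
Definition tp_over L (M : structure L) V (b : V -> M) (A : set M) :
    set (formula L (V + A)) :=
  tp (tcat b (set_val : A -> M)).

Arguments tp_over {L M V} b A.

Definition finitely_sat L (M : structure L) V (A : set M)
    (p : set (formula L (V + A))) : Prop :=
  forall q, finite_set q -> q `<=` p ->
    exists b : V -> M, realizes (tcat b (set_val : A -> M)) q.

Definition fun_closed L (M : structure L) (A : set M) : Prop :=
  forall (f : fsym L) (v : 'I_(farity f) -> A),
    fun_interp f (set_val \o v) \in A.

Lemma set_type_inhabited X (A : set X) : A !=set0 -> inhabited A.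
Proof. by case=> x Ax; constructor; exists x; apply/mem_set. Qed.

Definition substructure L (M : structure L) (A : set M) (A0 : A !=set0)
    (AF : fun_closed A) : structure L :=
  @Structure L A (set_type_inhabited A0)
    (fun f v => exist _ (fun_interp f (set_val \o v)) (AF f v))
    (fun r v => rel_interp r (set_val \o v)).

Definition elementary_substructure L (M : structure L) (A : set M) : Prop :=
  exists (A0 : A !=set0) (AF : fun_closed A),
    forall V (v : V -> substructure A0 AF) (phi : formula L V),
      sat v phi <-> sat ((set_val : A -> M) \o v) phi.

(** * The automorphism group *)

Record aut L (M : structure L) := Aut {
  aut_fun :> M -> M;
  aut_inv : M -> M;
  aut_funK : cancel aut_fun aut_inv;
  aut_invK : cancel aut_inv aut_fun;
  aut_fsym : forall (f : fsym L) (v : 'I_(farity f) -> M),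
    aut_fun (fun_interp f v) = fun_interp f (aut_fun \o v);
  aut_rsym : forall (r : rsym L) (v : 'I_(rarity r) -> M),
    rel_interp r (aut_fun \o v) <-> rel_interp r v }.

Lemma aut_eq L (M : structure L) (f g : aut M) :
  aut_fun f = aut_fun g -> f = g.
Proof.
case: f g => [f f' fK f'K ff fr] [g g' gK g'K gf gr] /= fg.
have fg' : f' = g'.
  by apply/funext => x; apply: (can_inj fK); rewrite f'K fg g'K.
move: fK f'K ff fr gK g'K gf gr; rewrite fg fg' => *.
by congr Aut; apply: Prop_irrelevance.
Qed.

Lemma aut_comp_subproof L (M : structure L) (f g : aut M) :
  [/\ cancel (f \o g) (aut_inv g \o aut_inv f),
      cancel (aut_inv g \o aut_inv f) (f \o g),
      (forall (s : fsym L) (v : 'I_(farity s) -> M),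
         (f \o g) (fun_interp s v) = fun_interp s ((f \o g) \o v)) &
      (forall (r : rsym L) (v : 'I_(rarity r) -> M),
         rel_interp r ((f \o g) \o v) <-> rel_interp r v)].
Proof.
split.
- exact: can_comp (@aut_funK _ _ f) (@aut_funK _ _ g).
- exact: can_comp (@aut_invK _ _ g) (@aut_invK _ _ f).
- by move=> s v /=; rewrite !aut_fsym.
- by move=> r v; rewrite -compA (aut_rsym f) (aut_rsym g).
Qed.

Definition aut_comp L (M : structure L) (f g : aut M) : aut M :=
  let: And4 fK f'K ff fr := aut_comp_subproof f g in Aut fK f'K ff fr.

Definition aut_id L (M : structure L) : aut M :=
  @Aut L M id id (fun=> erefl) (fun=> erefl)
    (fun _ _ => erefl) (fun _ _ => iff_refl _).

Lemma aut_inv_subproof L (M : structure L) (f : aut M) :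
  (forall (s : fsym L) (v : 'I_(farity s) -> M),
     aut_inv f (fun_interp s v) = fun_interp s (aut_inv f \o v)) /\
  (forall (r : rsym L) (v : 'I_(rarity r) -> M),
     rel_interp r (aut_inv f \o v) <-> rel_interp r v).
Proof.
have fv n (v : 'I_n -> M) : f \o (aut_inv f \o v) = v.
  by apply/funext => i /=; rewrite aut_invK.
split=> [s v|r v]; last by rewrite -(aut_rsym f) fv.
by apply: (can_inj (@aut_funK _ _ f)); rewrite aut_invK aut_fsym fv.
Qed.

Definition aut_inverse L (M : structure L) (f : aut M) : aut M :=
  Aut (@aut_invK _ _ f) (@aut_funK _ _ f)
    (proj1 (aut_inv_subproof f)) (proj2 (aut_inv_subproof f)).

HB.instance Definition _ L (M : structure L) := gen_eqMixin (aut M).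
HB.instance Definition _ L (M : structure L) := gen_choiceMixin (aut M).

Lemma aut_compE L (M : structure L) (f g : aut M) :
  aut_fun (aut_comp f g) = f \o g.
Proof. by rewrite /aut_comp; case: aut_comp_subproof. Qed.

Lemma aut_compA L (M : structure L) : associative (@aut_comp L M).
Proof. by move=> f g h; apply: aut_eq; rewrite !aut_compE. Qed.

Lemma aut_comp1f L (M : structure L) : left_id (aut_id M) (@aut_comp L M).
Proof. by move=> f; apply: aut_eq; rewrite aut_compE. Qed.

Lemma aut_compf1 L (M : structure L) : right_id (aut_id M) (@aut_comp L M).
Proof. by move=> f; apply: aut_eq; rewrite aut_compE. Qed.

Lemma aut_compVf L (M : structure L) :
  left_inverse (aut_id M) (@aut_inverse L M) (@aut_comp L M).
Proof.
move=> f; apply: aut_eq; rewrite aut_compE; apply/funext => x /=.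
exact: aut_funK.
Qed.

Lemma aut_compfV L (M : structure L) :
  right_inverse (aut_id M) (@aut_inverse L M) (@aut_comp L M).
Proof.
move=> f; apply: aut_eq; rewrite aut_compE; apply/funext => x /=.
exact: aut_invK.
Qed.

HB.instance Definition _ L (M : structure L) :=
  isGroup.Build (aut M) (@aut_compA L M) (@aut_comp1f L M) (@aut_compf1 L M)
    (@aut_compVf L M) (@aut_compfV L M).

(** * Monster models *)

(* The cardinal kappa-bar is represented by a type [K] of that cardinality;
   [small K I] says that [I] has cardinality < kappa-bar. *)
Definition small (K I : Type) : Prop :=
  ([set: I] #<= [set: K]) /\ ~ ([set: K] #<= [set: I]).

Definition saturated (K : Type) L (M : structure L) : Prop :=
  forall (A : set M) (p : set (formula L (unit + A))),
    small K A -> finitely_sat p ->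
    exists b : unit -> M, realizes (tcat b (set_val : A -> M)) p.

Definition strongly_homogeneous (K : Type) L (M : structure L) : Prop :=
  forall (I : Type) (b c : I -> M),
    small K I -> tp b = tp c -> exists f : aut M, f \o b = c.

(* [formula L nat] has cardinality |T|, the number of formulas of the
   language up to renaming variables; in particular [K] is uncountable. *)
Definition monster (K : Type) L (T : set (sentence L)) (M : structure L) :
    Prop :=
  [/\ model_of T M, small K (formula L nat), saturated K M
    & strongly_homogeneous K M].

(** * Hyperimaginaries *)

(* Equivalence relations on [I]-tuples that are type-definable over the empty
   set. *)
Record tdequiv L (M : structure L) (I : Type) := Tdequiv {
  tde_type : set (formula L (I + I));
  tde_refl : forall b : I -> M, realizes (tcat b b) tde_type;
  tde_sym : forall b c : I -> M,
    realizes (tcat b c) tde_type -> realizes (tcat c b) tde_type;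
  tde_trans : forall b c d : I -> M,
    realizes (tcat b c) tde_type -> realizes (tcat c d) tde_type ->
    realizes (tcat b d) tde_type }.

Definition tde_rel L (M : structure L) I (F : tdequiv M I) (b c : I -> M) :
    Prop :=
  realizes (tcat b c) (tde_type F).

Coercion tde_rel : tdequiv >-> Funclass.

(* A hyperimaginary b_F is given by [F] and the representative [b]; thus
   b_F = c_F reads [F b c] and f(b_F) = c_F reads [F (f \o b) c].  The fixed
   hyperimaginary e is given by [E] and [a]. *)

Definition Aute L (M : structure L) I (E : tdequiv M I) (a : I -> M) :
    set (aut M) :=
  [set f : aut M | E (f \o a) a].

Arguments Aute {L M I} E a.

Definition fixes L (M : structure L) (f : aut M) (A : set M) : Prop :=
  forall x, A x -> f x = x.

Definition in_dcl L (M : structure L) I (E : tdequiv M I) (a : I -> M)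
    (A : set M) : Prop :=
  forall f : aut M, fixes f A -> E (f \o a) a.

Definition small_model (K : Type) L (M : structure L) I (E : tdequiv M I)
    (a : I -> M) (A : set M) : Prop :=
  [/\ elementary_substructure A, small K A & in_dcl E a A].

Definition is_subgroup (G : groupType) (H : set G) : Prop :=
  group_closed (mem H).

Definition Autfe (K : Type) L (M : structure L) I (E : tdequiv M I)
    (a : I -> M) : set (aut M) :=
  smallest (@is_subgroup (aut M))
    [set f : aut M | Aute E a f /\
       exists2 A, small_model K E a A & fixes f A].

Arguments Autfe K {L M I} E a.

Definition lascar_equiv (K : Type) L (M : structure L) I (E : tdequiv M I)
    (a : I -> M) J (F : tdequiv M J) (b c : J -> M) : Prop :=
  exists2 f : aut M, Autfe K E a f & F (f \o b) c.

(* e-indiscernibility of the sequence of hyperimaginaries (s i)/F. *)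
Definition indiscernible L (M : structure L) I (E : tdequiv M I) (a : I -> M)
    J (F : tdequiv M J) (s : nat -> J -> M) : Prop :=
  forall (n : nat) (i : 'I_n.+1 -> nat),
    {homo i : k l / (k < l)%N} ->
    exists2 f : aut M, Aute E a f &
      forall k : 'I_n.+1, F (f \o s k) (s (i k)).

(* d_e(b_F, d_F) <= n.  This is a relation between classes, so the endpoints of
   the path are only required to represent b_F and d_F. *)
Definition lascar_dist_le L (M : structure L) I (E : tdequiv M I)
    (a : I -> M) J (F : tdequiv M J) (n : nat) (b d : J -> M) : Prop :=
  exists p : nat -> J -> M,
    [/\ F b (p 0), F (p n) d &
      forall i, (i < n)%N -> exists s : nat -> J -> M,
        [/\ indiscernible E a F s, F (s 0) (p i) & F (s 1) (p i.+1)]].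

(** * The Stone space *)

(* S_V(A): the complete types over A in variables [V], as maximal finitely
   satisfiable sets of formulas. *)
Definition complete_type L (M : structure L) V (A : set M) :
    set (set (formula L (V + A))) :=
  [set p | finitely_sat p /\ forall phi, p phi \/ p (Neg phi)].

Arguments complete_type {L M} V A.

Definition stone L (M : structure L) V (A : set M) : Type :=
  complete_type V A.

HB.instance Definition _ L V := gen_eqMixin (formula L V).
HB.instance Definition _ L V := gen_choiceMixin (formula L V).
HB.instance Definition _ L V := isPointed.Build (formula L V) Bot.

HB.instance Definition _ L (M : structure L) V (A : set M) :=
  gen_eqMixin (stone V A).
HB.instance Definition _ L (M : structure L) V (A : set M) :=
  gen_choiceMixin (stone V A).
HB.instance Definition _ L (M : structure L) V (A : set M) :=
  isSubBaseTopological.Build (stone V A) [set: formula L (V + A)]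
    (fun phi => [set p : stone V A | set_val p phi]).

(** * The Lascar group over e *)

(* S_A(B) for models A and B; variables are indexed by the elements of A. *)
Definition SMN L (M : structure L) I (E : tdequiv M I) (a : I -> M)
    (A B : set M) : set (stone A B) :=
  [set p : stone A B | exists f : Aute E a,
     set_val p = tp_over (set_val f \o (set_val : A -> M)) B].

Arguments SMN {L M I} E a A B.

Lemma Autfe_subgroup K L (M : structure L) I (E : tdequiv M I) (a : I -> M) :
  is_subgroup (Autfe K E a).
Proof.
split=> [|f g /set_mem Hf /set_mem Hg].
  by apply/mem_set => H [[/set_mem]].
apply/mem_set => H sH; have [[_ HV] _] := sH.
by apply/set_mem/HV; apply/mem_set; [exact: Hf|exact: Hg].
Qed.

Definition galeq K L (M : structure L) I (E : tdequiv M I) (a : I -> M) :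
    rel (Aute E a) :=
  fun f g => ((set_val f)^-1 * set_val g)%g \in Autfe K E a.

Lemma galeq_equiv K L (M : structure L) I (E : tdequiv M I) (a : I -> M) :
  equiv_class_of (@galeq K L M I E a).
Proof.
have SH := Autfe_subgroup K E a.
have inV := group_closedV SH; have inM := group_closedM SH.
split=> [f|f g|g f h]; rewrite /galeq.
- by rewrite mulVg; case: SH.
- by apply/idP/idP => /inV; rewrite invgM invgK.
- by move=> fg gh; have := inM _ _ fg gh; rewrite mulgA mulgK.
Qed.

Canonical galeq_equiv_rel K L (M : structure L) I (E : tdequiv M I)
    (a : I -> M) :=
  EquivRelPack (@galeq_equiv K L M I E a).

(* Aut_e / Autf_e, as the set of cosets f Autf_e; the trivial subgroup is the
   class of 1. *)
Definition Gal K L (M : structure L) I (E : tdequiv M I) (a : I -> M) : Type :=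
  {eq_quot (galeq_equiv_rel K E a)}%qT.

Lemma Aute1 L (M : structure L) I (E : tdequiv M I) (a : I -> M) :
  (1%g : aut M) \in Aute E a.
Proof. by apply/mem_set; exact: tde_refl. Qed.

Arguments Gal K {L M I} E a.

HB.instance Definition _ K L (M : structure L) I (E : tdequiv M I)
    (a : I -> M) := Choice.on (Gal K E a).

Definition gal_pi K L (M : structure L) I (E : tdequiv M I) (a : I -> M)
    (f : Aute E a) : Gal K E a := \pi_(Gal K E a)%qT f.

Arguments gal_pi K {L M I E a} f.

(* The map S_A(B) -> Gal, tp(f(A)/B) |-> pi(f).  When A and B are small models
   with e in their definable closure, it does not depend on the choice of f. *)
Definition nu K L (M : structure L) I (E : tdequiv M I) (a : I -> M)
    (A B : set M) (p : SMN E a A B) : Gal K E a :=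
  gal_pi K (sval (cid (set_valP p))).

(* The quotient topology along [nu], required for all choices of small models A
   and B (the topology does not depend on that choice). *)
Definition gal_open K L (M : structure L) I (E : tdequiv M I) (a : I -> M) :
    set_system (Gal K E a) :=
  [set U | forall A B : set M, small_model K E a A -> small_model K E a B ->
     open ((@nu K L M I E a A B) @^-1` U)].

Lemma gal_openT K L (M : structure L) I (E : tdequiv M I) (a : I -> M) :
  @gal_open K L M I E a setT.
Proof. by move=> A B _ _; rewrite preimage_setT; exact: openT. Qed.

Lemma gal_openI K L (M : structure L) I (E : tdequiv M I) (a : I -> M) :
  setI_closed (@gal_open K L M I E a).
Proof.
by move=> U V oU oV A B hA hB; apply: openI; [exact: oU|exact: oV].
Qed.

Lemma gal_open_bigU K L (M : structure L) I (E : tdequiv M I) (a : I -> M)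
    (X : Type) (U : X -> set (Gal K E a)) :
  (forall i, @gal_open K L M I E a (U i)) ->
  @gal_open K L M I E a (\bigcup_i U i).
Proof.
move=> oU A B hA hB; rewrite preimage_bigcup.
by apply: bigcup_open => i _; exact: oU.
Qed.

HB.instance Definition _ K L (M : structure L) I (E : tdequiv M I)
    (a : I -> M) :=
  isOpenTopological.Build (Gal K E a) (@gal_openT K L M I E a)
    (@gal_openI K L M I E a) (@gal_open_bigU K L M I E a).

Definition G_compact K L (M : structure L) I (E : tdequiv M I) (a : I -> M) :
    Prop :=
  closed [set gal_pi K (exist _ 1%g (Aute1 E a) : Aute E a)].

(* Main.v *)
Require Import Defs.
From mathcomp Require Import all_boot.
From mathcomp Require Import all_classical topology.
(* Imported again because [topology] shadows [Defs.eval]. *)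
Require Import Defs.

Set Implicit Arguments.
Unset Strict Implicit.
Unset Printing Implicit Defensive.

Local Open Scope classical_set_scope.
Local Open Scope card_scope.

(** Call an automorphism elementary strong if it fixes pointwise a small model N
    with e in dcl(N), and let [strong_dist n b c] say that a product of n of
    them sends b_F to c_F.  Fix a small model A containing a.  One such step
    from b_F to c_F exists iff some copy y of A, in the same class for E,
    satisfies b' =_y c' for some representatives b', c': realize over N, b, c a
    coheir of tp(A/N).  Hence [strong_dist n] is type-definable over a.  Two
    terms of an e-indiscernible sequence are one step apart (pigeonhole and
    compactness), and one step costs at most 2 in Lascar distance (Morley
    sequences of a coheir), so Lascar equivalence is the union of the relations
    [strong_dist n].

    (1) => (2): {1} closed means that Autf_e is a closed condition on
    tp(f(A)/A) for A containing a, b; project it, and use invariance to lower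
    the parameters to ab.  (2) => (3): in the flow of ultrafilters on the orbit
    of b_F, take a minimal subflow.  By Baire, some nonempty open subset of it
    lies within bounded distance of b_F; finitely many translates cover the
    subflow, so all of its points are at distance <= N from every point of the
    orbit, whose diameter is then at most 2N.  (3) => (4): apply (3) to an
    enumeration of A to write each f in Autf_e as a product of boundedly many
    elementary strong automorphisms.  (4) => (1): Lascar equivalence on
    enumerations of models is now type-definable. *)

(** * Cardinalities of small types *)

Lemma card_leT X Y :
  ([set: X] #<= [set: Y]) <-> exists f : X -> Y, injective f.
Proof.
split=> [/card_leP[f]|[f f_inj]].
  pose j (x : X) : [set: X] := exist _ x (mem_set Logic.I).
  exists (fun x => val (f (j x))) => x y /val_inj fxy.
  by have /(_ (j x) (j y)) := @inj _ _ _ f; rewrite !inE => /(_ Logic.I Logic.I fxy)[].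
have [x0|X0] := pselect (inhabited X); last first.
  suff -> : [set: X] = set0 by exact: card_ge0.
  by apply/seteqP; split=> // x; case: X0; constructor.
apply: card_le_trans (card_leT (f @` setT)).
have : f @` setT #= [set: X] by apply: inj_card_eq => x y _ _ /f_inj.
by rewrite card_eq_le => /andP[].
Qed.

(** Zorn's lemma on partial injections, kept as graphs: a maximal one that missed a point on each
    side could be enlarged by that pair. *)
Lemma card_comparable X Y (A : set X) (B : set Y) :
  exists R : X -> Y -> Prop,
    [/\ forall x y, R x y -> A x /\ B y,
        forall x y y', R x y -> R x y' -> y = y',
        forall x x' y, R x y -> R x' y -> x = x' &
        (forall x, A x -> exists y, R x y) \/
        (forall y, B y -> exists x, R x y)].
Proof.
pose P (G : set (X * Y)) := [/\ forall x y, G (x, y) -> A x /\ B y,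
  forall x y y', G (x, y) -> G (x, y') -> y = y' &
  forall x x' y, G (x, y) -> G (x', y) -> x = x'].
have [|G [[GAB Gf Gi] Gmax]] := @Zorn_bigcup _ P.
  move=> F FP Ftot; split.
  - by move=> x y [G FG]; have [+ _ _] := FP _ FG; apply.
  - move=> x y y' [G FG Gy] [G' FG' Gy'].
    have [_ fG _] := FP _ FG; have [_ fG' _] := FP _ FG'.
    by have [/(_ _ Gy)|/(_ _ Gy')] := Ftot _ _ FG FG' => ?;
      [apply: fG'|apply: fG]; eassumption.
  - move=> x x' y [G FG Gy] [G' FG' Gy'].
    have [_ _ fG] := FP _ FG; have [_ _ fG'] := FP _ FG'.
    by have [/(_ _ Gy)|/(_ _ Gy')] := Ftot _ _ FG FG' => ?;
      [apply: fG'|apply: fG]; eassumption.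
exists (fun x y => G (x, y)); split=> //.
apply: contrapT => /not_orP[/existsNP[x /not_implyP[Ax nx]]].
move=> /existsNP[y /not_implyP[By ny]].
apply: (Gmax (G `|` [set (x, y)])).
  split; first by move=> z Gz; left.
  by move=> GG; apply: nx; exists y; apply: GG; right.
split.
- by move=> x' y' [/GAB//|[-> ->]].
- move=> x' y' y'' [G'|[ex' ey']] [G''|[ex'' ey'']]; subst=> //.
  + exact: Gf G' G''.
  + by case: nx; exists y'.
  + by case: nx; exists y''.
- move=> x' x'' y' [G'|[ex' ey']] [G''|[ex'' ey'']]; subst=> //.
  + exact: Gi G' G''.
  + by case: ny; exists x'.
  + by case: ny; exists x''.
Qed.

Lemma inj_comparable X Y :
  (exists f : X -> Y, injective f) \/ (exists f : Y -> X, injective f).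
Proof.
have [R [_ Rf Ri [tot|tot]]] := @card_comparable X Y setT setT.
- have [f Rx] := choice (fun x => tot x Logic.I).
  by left; exists f => x x' e; apply: Ri (Rx x) _; rewrite e.
- have [f Rx] := choice (fun y => tot y Logic.I).
  by right; exists f => y y' e; apply: Rf (Rx y) _; rewrite e.
Qed.

(** Zorn's lemma on injective pairings of a subset D of [X] with values in D. If the complement of D
    embeds in D, then [X] embeds in D and inherits its pairing. Otherwise D embeds in its complement
    and the pairing extends to a second copy of D, against maximality. *)
Lemma infinite_sqr X (i : nat -> X) : injective i ->
  exists f : X * X -> X, injective f.
Proof.
move=> i_inj.
pose dom (G : set (X * X * X)) x := exists z, G ((x, x), z).
(* The last clause admits the empty relation, because the union of the empty chain has to satisfy
   [P]. *)
pose P (G : set (X * X * X)) := [/\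
  forall p z z', G (p, z) -> G (p, z') -> z = z',
  forall p p' z, G (p, z) -> G (p', z) -> p = p',
  forall x y z, G ((x, y), z) -> [/\ dom G x, dom G y & dom G z],
  forall x y, dom G x -> dom G y -> exists z, G ((x, y), z) &
  (forall n, dom G (i n)) \/ (forall t, ~ G t)].
have [|G [[Gf Gi Gd Gt G0] Gmax]] := @Zorn_bigcup _ P.
  move=> F FP Ftot.
  have domF G x : F G -> dom G x -> dom (\bigcup_(G in F) G) x.
    by move=> FG [z Gz]; exists z, G.
  have two p q : (\bigcup_(G in F) G) p -> (\bigcup_(G in F) G) q ->
      exists2 G, F G & G p /\ G q.
    move=> [G FG Gp] [G' FG' Gq]; have [GG'|GG'] := Ftot _ _ FG FG'.
      by exists G' => //; split=> //; exact: GG'.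
    by exists G => //; split=> //; exact: GG'.
  split.
  - by move=> p z z' Gz Gz'; have [G /FP[Gf _ _ _ _] []] := two _ _ Gz Gz'; exact: Gf.
  - by move=> p z z' Gz Gz'; have [G /FP[_ Gi _ _ _] []] := two _ _ Gz Gz'; exact: Gi.
  - move=> x y z [G FG] /=; have [_ _ Gd _ _] := FP _ FG.
    by move=> /Gd[dx dy dz]; split; exact: (domF _ _ FG).
  - move=> x y [z Gz] [z' Gz'].
    have [G FG [Gx Gy]] := two _ _ Gz Gz'.
    have [_ _ _ Gt _] := FP _ FG; have [||w Gw] := Gt x y.
    + by exists z.
    + by exists z'.
    + by exists w, G.
  - have [[t [G FG Gx]]|nG] := pselect (exists t, (\bigcup_(G in F) G) t);
      last by right=> t Gx; apply: nG; exists t.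
    left=> n; apply: (domF _ _ FG); have [_ _ _ _ [//|nG]] := FP _ FG.
    by have := nG _ Gx.
have {}G0 : forall n, dom G (i n).
  case: G0 => // G0; exfalso.
  (* A maximal [G] is not empty: the pairing of natural numbers by [pickle], carried along [i], is
     larger than the empty relation. *)
  pose B := [set t : X * X * X | exists n m,
    t = ((i n, i m), i (pickle (n, m)))].
  have dB n : dom B (i n) by exists (i (pickle (n, n))), n, n.
  have Bd x : dom B x -> exists n, x = i n by move=> [z [n [m [-> _ _]]]]; exists n.
  apply: (Gmax B); first split.
  - by move=> t /G0.
  - by move=> /(_ ((i 0, i 0), i (pickle (0, 0)))) BG; apply: (G0 _ (BG _)); exists 0, 0.
  split.
  - by move=> p z z' [n [m [-> ->]]] [n' [m' [/i_inj -> /i_inj -> ->]]].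
  - move=> p p' z [n [m [-> ->]]] [n' [m' [-> /i_inj e]]].
    by have [-> ->] := pcan_inj pickleK e.
  - by move=> x y z [n [m [-> -> ->]]].
  - by move=> x y /Bd[n ->] /Bd[m ->]; eexists; exists n, m.
  - by left.
have [e eG] : {e : X * X -> X & forall p, dom G p.1 -> dom G p.2 -> G (p, e p)}.
  apply: (@choice _ _ (fun p z => dom G p.1 -> dom G p.2 -> G (p, z))) => -[x y].
  have [[dx dy]|n] := pselect (dom G x /\ dom G y).
    by have [z] := Gt _ _ dx dy; exists z.
  by exists (i 0) => dx dy; case: n.
have ed x y : dom G x -> dom G y -> dom G (e (x, y)).
  by move=> dx dy; have /= := eG (x, y) dx dy; move=> /Gd[].
have e_inj x y x' y' : dom G x -> dom G y -> dom G x' -> dom G y' ->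
    e (x, y) = e (x', y') -> x = x' /\ y = y'.
  move=> dx dy dx' dy' exy; have /= Gxy := eG (x, y) dx dy.
  have /= Gxy' := eG (x', y') dx' dy'; rewrite -exy in Gxy'.
  by have [] := Gi _ _ _ Gxy Gxy'.
have i01 : i 0 <> i 1 by move/i_inj.
have [R [RAB Rf Ri [RA|RB]]] := @card_comparable _ _ (dom G) (~` dom G); last first.
  have [j jR] : {j : X -> X & forall x, ~ dom G x -> R (j x) x}.
    apply: (@choice _ _ (fun x z => ~ dom G x -> R z x)) => x.
    have [dx|dx] := pselect (dom G x); first by exists x.
    by have [z] := RB x dx; exists z.
  (* [h] embeds [X] in [dom G]; the tags [i 0] and [i 1] keep the two halves apart. *)
  pose h x := if pselect (dom G x) then e (x, i 0) else e (j x, i 1).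
  have jd x : ~ dom G x -> dom G (j x) by move=> /jR/RAB[].
  have hd x : dom G (h x).
    by rewrite /h; case: pselect => dx; apply: ed => //; exact: jd.
  have h_inj : injective h.
    move=> x y; rewrite /h; case: pselect => dx; case: pselect => dy.
    - by move=> /e_inj[].
    - by move=> /e_inj[] //; exact: jd.
    - by move=> /e_inj[] //; [exact: jd|move=> _ /esym].
    - move=> /e_inj[] //; [exact: jd|exact: jd|move=> jxy _].
      by apply: Rf (jR _ dx) _; rewrite jxy; exact: jR.
  exists (fun p => e (h p.1, h p.2)) => -[x y] [x' y'] /= /e_inj[] //.
  by move=> /h_inj -> /h_inj ->.
exfalso.
have [j jR] : {j : X -> X & forall x, dom G x -> R x (j x)}.
  apply: (@choice _ _ (fun x z => dom G x -> R x z)) => x.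
  have [dx|dx] := pselect (dom G x); last by exists x.
  by have [z] := RA x dx; exists z.
have jd x : dom G x -> ~ dom G (j x) by move=> /jR/RAB[].
have j_inj x y : dom G x -> dom G y -> j x = j y -> x = y.
  by move=> /jR dx /jR dy jxy; rewrite jxy in dx; exact: Ri dx dy.
have [k kj] : exists k : X -> X, forall x, dom G x -> k (j x) = x.
  have [k kP] : {k : X -> X & forall z, forall x, dom G x -> z = j x -> k z = x}.
    apply: (@choice _ _ (fun z t => forall x, dom G x -> z = j x -> t = x)) => z.
    have [[x [dx ->]]|nz] := pselect (exists x, dom G x /\ z = j x).
      by exists x => y dy /(j_inj _ _ dx dy).
    by exists z => x dx zx; case: nz; exists x.
  by exists k => x dx; exact: kP.
pose S1 x := dom G x \/ exists2 y, dom G y & x = j y.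
pose c x := if pselect (dom G x) then e (x, i 0) else e (k x, i 1).
have cd x : S1 x -> dom G (c x).
  rewrite /c => Sx; case: pselect => dx /=; first exact: ed.
  by case: Sx => // -[y dy xy]; apply: ed => //; rewrite xy kj.
have c_inj x y : S1 x -> S1 y -> c x = c y -> x = y.
  have kd z : S1 z -> ~ dom G z -> dom G (k z).
    by case=> // -[t dt ->]; rewrite kj.
  move=> Sx Sy; rewrite /c; case: pselect => dx; case: pselect => dy.
  - by move=> /e_inj[].
  - by move=> /e_inj[] //; exact: kd.
  - by move=> /e_inj[] //; [exact: kd|move=> _ /esym].
  - move=> /e_inj[] //; [exact: kd|exact: kd|].
    case: Sx dx => // -[x' dx' ->] _; case: Sy dy => // -[y' dy' ->] _.
    by rewrite !kj// => ->.
(* With [c] embedding [S1] in [dom G], each new pair is coded in [dom G] and its code is moved by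
   [j] to the disjoint copy, so no value of [G] is taken twice. *)
pose G' := G `|` [set t | exists x y, [/\ S1 x, S1 y, ~ (dom G x /\ dom G y) &
  t = ((x, y), j (e (c x, c y)))]].
have GG' x : dom G x -> dom G' x by move=> [z Gz]; exists z; left.
have dG'1 x : dom G' x -> S1 x.
  move=> [z [Gz|[x' [y' [Sx' Sy' _ [-> _ _]]]]]] //; left; by exists z.
have dG'2 x : S1 x -> dom G' x.
  have [/GG'//|dx] := pselect (dom G x) => Sx.
  by exists (j (e (c x, c x))); right; exists x, x; split=> // -[].
apply: (Gmax G'); first split.
- by move=> t; left.
- move=> G'G; apply: (jd _ (G0 0)).
  have [z Gz] : dom G' (j (i 0)) by apply: dG'2; right; exists (i 0).
  by exists z; exact: G'G.
have S1d x y z : G ((x, y), z) -> dom G x /\ dom G y by move=> /Gd[].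
split.
- move=> p z z' [Gz|[x [y [Sx Sy nxy [ep ez]]]]] [Gz'|[x' [y' [Sx' Sy' nxy' [ep' ez']]]]].
  + exact: Gf Gz Gz'.
  + by case: nxy'; apply: (S1d _ _ z); rewrite -ep'.
  + by case: nxy; apply: (S1d _ _ z'); rewrite -ep.
  + by rewrite ez ez'; move: ep'; rewrite ep => -[-> ->].
- have jn (x y : X) z p : S1 x -> S1 y -> G (p, j (e (c x, c y))) -> z.
    move=> Sx Sy; case: p => p1 p2 /Gd[_ _ dj].
    by case: (jd (e (c x, c y))) => //; apply: ed; exact: cd.
  move=> p p' z [Gz|[x [y [Sx Sy nxy [ep ez]]]]] [Gz'|[x' [y' [Sx' Sy' nxy' [ep' ez']]]]].
  + exact: Gi Gz Gz'.
  + by apply: (jn x' y' _ p) => //; rewrite -ez'.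
  + by apply: (jn x y _ p') => //; rewrite -ez.
  + have /j_inj ej : j (e (c x, c y)) = j (e (c x', c y')) by rewrite -ez.
    have [] := e_inj _ _ _ _ (cd _ Sx) (cd _ Sy) (cd _ Sx') (cd _ Sy')
      (ej (ed _ _ (cd _ Sx) (cd _ Sy)) (ed _ _ (cd _ Sx') (cd _ Sy'))).
    by rewrite ep ep' => /c_inj -> // /c_inj -> //.
- move=> x y z [/Gd[dx dy dz]|[x' [y' [Sx Sy nxy [-> -> ->]]]]].
    by split; exact: GG'.
  split; [exact: dG'2|exact: dG'2|].
  by apply: dG'2; right; eexists; last reflexivity; apply: ed; exact: cd.
- move=> x y /dG'1 Sx /dG'1 Sy.
  have [[dx dy]|nxy] := pselect (dom G x /\ dom G y).
    by have [z Gz] := Gt _ _ dx dy; exists z; left.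
  by exists (j (e (c x, c y))); right; exists x, y.
- by left=> n; exact: GG'.
Qed.

(** Iterated pairing is injective only among lists of equal length, so the length is coded as
    well. *)
Lemma infinite_seq X (i : nat -> X) : injective i ->
  exists f : seq X -> X, injective f.
Proof.
move=> i_inj; have [p p_inj] := infinite_sqr i_inj.
pose f := foldr (fun x y => p (x, y)) (i 0).
exists (fun s => p (i (size s), f s)) => s t /p_inj[] /i_inj.
elim: s t => [|x s IHs] [|y t] //= [st] /p_inj[-> ft].
by rewrite (IHs t st ft).
Qed.

Section Small.
Variables (K : Type) (L : language).
Hypothesis hK : small K (formula L nat).

Lemma small_inj X Y (f : X -> Y) : injective f -> small K Y -> small K X.
Proof.
move=> f_inj [/card_leT[g g_inj] nY]; split.
  by apply/card_leT; exists (g \o f); exact: inj_comp.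
move=> /card_leT[h h_inj]; apply: nY; apply/card_leT.
by exists (f \o h); exact: inj_comp.
Qed.

Lemma formula_nat_inj : exists i : nat -> formula L nat, injective i.
Proof. by exists (fun n => Eq (Var L n) (Var L n)) => n m []. Qed.

(* [Z] is infinite because it is enlarged to contain [formula L nat]. *)
Lemma small_cover X Y : small K X -> small K Y ->
  exists Z, [/\ small K Z, exists i : nat -> Z, injective i,
    exists f : X -> Z, injective f & exists f : Y -> Z, injective f].
Proof.
have [i i_inj] := formula_nat_inj.
suff one A B : small K A -> small K B -> exists Z, [/\ small K Z,
    exists f : A -> Z, injective f & exists f : B -> Z, injective f].
  move=> sX sY; have [Z [sZ [f f_inj] [g g_inj]]] := one _ _ sX sY.
  have [W [sW [h h_inj] [k k_inj]]] := one _ _ sZ hK.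
  exists W; split=> //.
  - by exists (k \o i); exact: inj_comp.
  - by exists (h \o f); exact: inj_comp.
  - by exists (h \o g); exact: inj_comp.
move=> sA sB; have [fAB|fBA] := inj_comparable A B.
  by exists B; split=> //; exists id.
by exists A; split=> //; exists id.
Qed.

Lemma small_prod X Y : small K X -> small K Y -> small K (X * Y).
Proof.
move=> sX sY; have [Z [sZ [i i_inj] [f f_inj] [g g_inj]]] := small_cover sX sY.
have [p p_inj] := infinite_sqr i_inj.
apply: (@small_inj _ _ (fun q => p (f q.1, g q.2))) sZ.
by move=> [x y] [x' y'] /= /p_inj[/f_inj -> /g_inj ->].
Qed.

Lemma small_sum X Y : small K X -> small K Y -> small K (X + Y).
Proof.
move=> sX sY; have [Z [sZ [i i_inj] [f f_inj] [g g_inj]]] := small_cover sX sY.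
have [p p_inj] := infinite_sqr i_inj.
apply: (@small_inj _ _ (fun q => match q with
  | inl x => p (i 0, f x) | inr y => p (i 1, g y) end)) sZ.
case=> [x|y] [x'|y'] /p_inj[]; [by move=> /f_inj ->| | |by move=> /g_inj ->];
  by move=> /i_inj.
Qed.

Lemma small_seq X : small K X -> small K (seq X).
Proof.
move=> sX; have [Z [sZ [i i_inj] [f f_inj] _]] := small_cover sX sX.
have [p p_inj] := infinite_seq i_inj.
apply: (@small_inj _ _ (fun s => p (map f s))) sZ.
by apply: inj_comp => //; exact: inj_map.
Qed.

Lemma small_nat : small K nat.
Proof. by have [i i_inj] := formula_nat_inj; exact: small_inj i_inj hK. Qed.

Lemma small_range X Y (f : X -> Y) : small K X -> small K (range f).
Proof.
have [g gK] : {g : range f -> X & forall y, f (g y) = val y}.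
  by apply: (@choice _ _ (fun y x => f x = val y)) => -[y /=] /set_mem[x _ <-]; exists x.
by apply: (@small_inj _ _ g) => y y' e; apply: val_inj; rewrite -!gK e.
Qed.

Lemma small_subset X (A B : set X) : A `<=` B -> small K B -> small K A.
Proof.
move=> AB; apply: (@small_inj _ _
  (fun x : A => exist _ (val x) (mem_set (AB _ (set_valP x))) : B)).
by move=> x y [e]; exact: val_inj.
Qed.

Lemma small_setU X (A B : set X) : small K A -> small K B ->
  small K (A `|` B).
Proof.
move=> sA sB; have sAB := small_sum sA sB.
apply: small_subset (small_range
  (fun t : A + B => match t with inl x => val x | inr y => val y end) sAB).
by move=> x [/mem_set Ax|/mem_set Bx];
  [exists (inl (exist _ x Ax))|exists (inr (exist _ x Bx))].
Qed.

End Small.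

(** * Renaming and quantifier closure of formulas *)

Fixpoint trename L V W (r : V -> W) (t : term L V) : term L W :=
  match t with
  | Var x => Var L (r x)
  | App f ts => App (fun i => trename r (ts i))
  end.

Fixpoint frename L V W (r : V -> W) (phi : formula L V) : formula L W :=
  match phi with
  | Bot => Bot
  | Eq t u => Eq (trename r t) (trename r u)
  | Rel s ts => Rel (fun i => trename r (ts i))
  | Imp phi psi => Imp (frename r phi) (frename r psi)
  | All phi => All (frename (omap r) phi)
  end.

Definition Ex L V (phi : formula L (option V)) : formula L V :=
  Neg (All (Neg phi)).

Definition And L V (phi psi : formula L V) : formula L V :=
  Neg (Imp phi (Neg psi)).

Section Syntax.
Variable L : language.

Lemma sat_And (M : structure L) V (v : V -> M) phi psi :
  sat v (And phi psi) <-> sat v phi /\ sat v psi.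
Proof.
split=> [/= np|/= [hp hq] h]; last exact: h.
by apply: contrapT => /not_andP h; apply: np => hp hq; case: h.
Qed.

Lemma sat_Ex (M : structure L) V (v : V -> M) phi :
  sat v (Ex phi) <-> exists x, sat (oapp v x) phi.
Proof.
split=> [/= np|/= [x hx] h]; last exact: h hx.
by apply: contrapT => /forallNP h; apply: np.
Qed.

Lemma eval_trename (M : structure L) V W (r : V -> W) (v : W -> M) t :
  eval v (trename r t) = eval (v \o r) t.
Proof.
elim: t => //= f ts IH; congr fun_interp; apply/funext => i; exact: IH.
Qed.

Lemma sat_frename (M : structure L) V (phi : formula L V) W (r : V -> W)
    (v : W -> M) :
  sat v (frename r phi) <-> sat (v \o r) phi.
Proof.
elim: phi W r v => {}V.
- by [].
- by move=> t u W r v /=; rewrite !eval_trename.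
- move=> s ts W r v /=; rewrite (_ : (fun i => _) = fun i => eval (v \o r) (ts i))//.
  by apply/funext => i; exact: eval_trename.
- by move=> phi IHp psi IHq W r v /=; rewrite IHp IHq.
- move=> phi IH W r v /=.
  suff e x : sat (oapp v x) (frename (omap r) phi) <-> sat (oapp (v \o r) x) phi.
    by split=> h x; apply/e.
  rewrite IH (_ : oapp v x \o omap r = oapp (v \o r) x)//.
  by apply/funext => -[].
Qed.

Lemma eval_aut (M : structure L) (f : aut M) V (v : V -> M) t :
  eval (f \o v) t = f (eval v t).
Proof.
by elim: t => //= s ts IH; rewrite aut_fsym; congr fun_interp; apply/funext.
Qed.

Lemma sat_aut (M : structure L) (f : aut M) V (phi : formula L V) (v : V -> M) :
  sat (f \o v) phi <-> sat v phi.
Proof.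
elim: phi v => {}V.
- by [].
- move=> t u v /=; rewrite !eval_aut; split=> [|-> //].
  exact: (can_inj (@aut_funK _ _ f)).
- move=> s ts v /=; rewrite -(aut_rsym f (fun i => eval v (ts i))).
  suff -> : (fun i => eval (f \o v) (ts i)) = f \o (fun i => eval v (ts i)) by [].
  by apply/funext => i; exact: eval_aut.
- by move=> phi IHp psi IHq v /=; rewrite IHp IHq.
- move=> phi IH v /=; split=> h x.
    rewrite -IH (_ : _ \o _ = oapp (f \o v) (f x)); first exact: h.
    by apply/funext => -[].
  rewrite (_ : oapp _ _ = f \o oapp v (aut_inv f x)); first by rewrite IH.
  by apply/funext => -[] //=; rewrite aut_invK.
Qed.

Lemma realizes_aut (M : structure L) (f : aut M) V p (v : V -> M) :
  realizes (f \o v) p <-> realizes v p.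
Proof. by split=> vp phi /vp; rewrite sat_aut. Qed.

(** Variables range over an arbitrary type, so finiteness of the set of occurring variables is
    expressed semantically, uniformly in the structure. *)
Lemma eval_support V (t : term L V) : exists2 S : set V, finite_set S &
  forall (M : structure L) (v v' : V -> M), {in S, v =1 v'} ->
  eval v t = eval v' t.
Proof.
elim: t => [x|f ts IH].
  by exists [set x] => [|M v v' /= ->//]; [exact: finite_set1|rewrite inE].
have /choice[S Sfin] i : exists S : set V, finite_set S /\
    forall (M : structure L) (v v' : V -> M), {in S, v =1 v'} ->
      eval v (ts i) = eval v' (ts i).
  by have [S] := IH i; exists S.
exists (\bigcup_i S i) => [|M v v' vv' /=].
  by apply: bigcup_finite => // i _; case: (Sfin i).
congr fun_interp; apply/funext => i; have [_] := Sfin i; apply=> x /set_mem Sx.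
by apply/vv'/mem_set; exists i.
Qed.

Lemma sat_support V (phi : formula L V) : exists2 S : set V, finite_set S &
  forall (M : structure L) (v v' : V -> M), {in S, v =1 v'} ->
  sat v phi <-> sat v' phi.
Proof.
elim: phi => {}V.
- by exists set0.
- move=> t u; have [S Sfin St] := eval_support t.
  have [S' Sfin' Su] := eval_support u; exists (S `|` S') => [|M v v' vv' /=].
    by rewrite finite_setU.
  rewrite (St _ _ v') ?(Su _ _ v')// => x /set_mem Sx; apply/vv'/mem_set.
    by right.
  by left.
- move=> s ts.
  have /choice[S Sfin] i : exists S : set V, finite_set S /\
      forall (M : structure L) (v v' : V -> M), {in S, v =1 v'} ->
        eval v (ts i) = eval v' (ts i).
    by have [S] := eval_support (ts i); exists S.
  exists (\bigcup_i S i) => [|M v v' vv' /=].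
    by apply: bigcup_finite => // i _; case: (Sfin i).
  rewrite (_ : (fun i => _) = fun i => eval v' (ts i))//.
  apply/funext => i; have [_] := Sfin i; apply=> x /set_mem Sx.
  by apply/vv'/mem_set; exists i.
- move=> phi [S Sfin Sp] psi [S' Sfin' Sq].
  exists (S `|` S') => [|M v v' vv' /=]; first by rewrite finite_setU.
  rewrite (Sp _ v v') ?(Sq _ v v')// => x /set_mem Sx; apply/vv'/mem_set.
    by right.
  by left.
- move=> phi [S Sfin Sp]; exists (Some @^-1` S) => [|M v v' vv' /=].
    by apply: finite_preimage => // x y _ _ [].
  suff e x : sat (oapp v x) phi <-> sat (oapp v' x) phi by split=> h x; apply/e.
  by apply: Sp => -[y|]//= /set_mem Sy; exact/vv'/mem_set.
Qed.

(** One variable is quantified away at a time: [r] turns the variable [ord0] into the bound variable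
    and shifts the others down. *)
Lemma ex_fin n V (phi : formula L (V + 'I_n)) : exists psi : formula L V,
  forall (M : structure L) (v : V -> M),
    sat v psi <-> exists w, sat (tcat v w) phi.
Proof.
elim: n V phi => [|n IHn] V phi.
  have no (i : 'I_0) : False by case: i.
  exists (frename (fun t : V + 'I_0 =>
    match t with inl x => x | inr i => False_rect _ (no i) end) phi) => M v.
  have e w : v \o (fun t : V + 'I_0 =>
      match t with inl x => x | inr i => False_rect _ (no i) end) = tcat v w.
    by apply/funext => -[].
  rewrite sat_frename; split=> [h|[w]]; last by rewrite -e.
  by exists (fun i => False_rect _ (no i)); rewrite -e.
pose r (t : V + 'I_n.+1) : option V + 'I_n := match t with
  | inl x => inl (Some x)
  | inr i => if unlift ord0 i is Some j then inr j else inl None end.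
have [psi psiP] := IHn _ (frename r phi); exists (Ex psi) => M v.
rewrite sat_Ex; split=> [[x /psiP[w /sat_frename h]]|[w h]].
  exists (tcat (oapp v x) w \o (fun i => r (inr i))); move: h.
  by rewrite (_ : _ \o r = tcat v (tcat (oapp v x) w \o (fun i => r (inr i))))//;
    apply/funext => -[].
exists (w ord0); apply/psiP; exists (w \o lift ord0); apply/sat_frename.
move: h; rewrite (_ : tcat v w = tcat (oapp v (w ord0)) (w \o lift ord0) \o r)//.
by apply/funext => -[//|i] /=; case: unliftP => [j|] ->.
Qed.

(** Only finitely many variables in [W] matter, so quantifying over a whole [W]-tuple is still
    first-order. *)
Lemma ex_close V W (phi : formula L (V + W)) : exists psi : formula L V,
  forall (M : structure L) (v : V -> M),
    sat v psi <-> exists w, sat (tcat v w) phi.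
Proof.
have [S Sfin Sp] := sat_support phi.
have /(@finite_seqP {classic W})[s sE] : finite_set (inr @^-1` S : set W).
  by apply: finite_preimage => // x y _ _ [].
pose ix (x : W) := index (x : {classic W}) s.
pose n := size s.
(* The extra index [n] receives all variables outside [s], whose [index] is [size s]. *)
have ixn x : (ix x < n.+1)%N by rewrite ltnS index_size.
pose r (t : V + W) : V + 'I_n.+1 := match t with
  | inl x => inl x | inr y => inr (Ordinal (ixn y)) end.
have [psi psiP] := ex_fin (frename r phi); exists psi => M v; rewrite psiP.
split=> [[w /sat_frename h]|[w h]].
  exists (fun y => w (Ordinal (ixn y))); move: h.
  by rewrite (_ : _ \o r = tcat v (fun y => w (Ordinal (ixn y))))//;
    apply/funext => -[].
have [m0] := carrier_nonempty M.
exists (fun i => nth m0 (map (w : {classic W} -> M) s) i); apply/sat_frename.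
move: h; rewrite (Sp _ _ (tcat v w \o id))//= (Sp _ _ (tcat v w))//.
apply: (iffLR (Sp _ _ _ _)) => -[//|y] /set_mem Sy /=.
have ys : (y : {classic W}) \in s.
  by have : [set` s] y by rewrite -sE.
by rewrite /ix (nth_map (y : {classic W})) ?index_mem// nth_index.
Qed.

Lemma finite_conj V (q : set (formula L V)) : finite_set q ->
  exists phi : formula L V, forall (M : structure L) (v : V -> M),
    sat v phi <-> realizes v q.
Proof.
move=> /finite_seqP[s ->]; elim: s => [|phi s [psi psiP]].
  by exists (Neg Bot) => M v; split=> // _ h /=.
exists (And phi psi) => M v; rewrite sat_And psiP; split.
  by move=> [hp hs] chi; rewrite /= inE => /orP[/eqP ->//|]; exact: hs.
move=> h; split; first by apply: h; rewrite /= inE eqxx.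
by move=> chi cs; apply: h; rewrite /= inE; apply/orP; right.
Qed.

Lemma realizesU (M : structure L) V (v : V -> M) p q :
  realizes v (p `|` q) <-> realizes v p /\ realizes v q.
Proof.
split=> [h|[hp hq] phi [/hp|/hq]//]; split=> phi hphi; apply: h;
  by [left|right].
Qed.

End Syntax.

(** * Compactness and type-definable sets *)

Lemma tcat_comp X Y V P (f : X -> Y) (x : V -> X) (c : P -> X) :
  f \o tcat x c = tcat (f \o x) (f \o c).
Proof. by apply/funext => -[]. Qed.

Section Compactness.
Variables (K : Type) (L : language) (M : structure L).
Hypothesis hK : small K (formula L nat).
Hypothesis hsat : saturated K M.

Let extends V (G : set (V * M)) (v : V -> M) := forall x y, G (x, y) -> v x = y.

Lemma total_bigcup_finite X (F : set (set X)) (s : set X) :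
  total_on F subset -> F !=set0 -> finite_set s ->
  s `<=` \bigcup_(G in F) G -> exists2 G, F G & s `<=` G.
Proof.
move=> Ftot F0 /(@finite_seqP {classic X})[{}s ->].
elim: s => [|x s IHs] sF; first by have [G FG] := F0; exists G.
have [G FG sG] : exists2 G, F G & [set` s] `<=` G.
  by apply: IHs => y ys; apply: sF; rewrite /= inE; apply/orP; right.
have [G' FG' xG'] : (\bigcup_(G in F) G) x by apply: sF; rewrite /= inE eqxx.
have [GG'|GG'] := Ftot _ _ FG FG'.
  exists G' => // y; rewrite /= inE => /orP[/eqP -> //|ys].
  exact/GG'/sG.
exists G => // y; rewrite /= inE => /orP[/eqP ->|ys]; first exact: GG'.
exact: sG.
Qed.

(** Saturation treats a single variable. By Zorn's lemma there is a maximal partial assignment [G]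
    that leaves every finite part of [p] solvable; it is total, since for an unassigned [x] the
    conditions on [x] form a finitely satisfiable type over a small set. *)
Lemma compactness V P (u : P -> M) (p : set (formula L (V + P))) :
  small K V -> small K P ->
  (forall q, finite_set q -> q `<=` p ->
     exists v : V -> M, realizes (tcat v u) q) ->
  exists v : V -> M, realizes (tcat v u) p.
Proof.
move=> sV sP fs; have [m0] := carrier_nonempty M.
pose good (G : set (V * M)) :=
  (forall x y y', G (x, y) -> G (x, y') -> y = y') /\
  forall q, finite_set q -> q `<=` p ->
    exists2 v : V -> M, extends G v & realizes (tcat v u) q.
have [|G [[Gf Gq] Gmax]] := @Zorn_bigcup _ good.
  move=> F FP Ftot.
  have Ff x y y' : (\bigcup_(G in F) G) (x, y) -> (\bigcup_(G in F) G) (x, y') ->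
      y = y'.
    move=> [G FG Gy] [G' FG' Gy'].
    have [/(_ _ Gy) Gy2|/(_ _ Gy') Gy2] := Ftot _ _ FG FG'.
      by have [/(_ _ _ _ Gy2 Gy')] := FP _ FG'.
    by have [/(_ _ _ _ Gy Gy2)] := FP _ FG.
  split=> // q qfin qp.
  have [F0|/nonemptyPn F0] := pselect (F !=set0); last first.
    have [v vq] := fs q qfin qp; exists v => // x y [G].
    by rewrite F0.
  (* Only the variables in the finite set [S] matter for [q]. Those among them that the chain
     assigns are all assigned by one member [G], and a solution extending [G] is corrected to [g] on
     the other assigned variables. *)
  have [phi phiP] := finite_conj qfin; have [S Sfin Sphi] := sat_support phi.
  pose U := \bigcup_(G in F) G.
  have [g gU] : {g : V -> M & forall x y, U (x, y) -> g x = y}.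
    apply: (@choice _ _ (fun x z => forall y, U (x, y) -> z = y)) => x.
    have [[y Uy]|nU] := pselect (exists y, U (x, y)).
      by exists y => y' Uy'; apply: Ff Uy Uy'.
    by exists m0 => y Uy; case: nU; exists y.
  pose s := [set t | S (inl t.1) /\ U t /\ t.2 = g t.1].
  have sfin : finite_set s.
    apply: (@sub_finite_set _ _ ((fun x => (x, g x)) @` (inl @^-1` S))).
      by move=> [x y] /= [Sx [_ /= ->]]; exists x.
    by apply: finite_image; apply: finite_preimage => // x y _ _ [].
  have [G FG sG] : exists2 G, F G & s `<=` G.
    by apply: total_bigcup_finite => // t [_ [Ut _]].
  have [_ Gq] := FP _ FG; have [v Gv vq] := Gq q qfin qp.
  exists (fun x => if pselect (exists y, U (x, y)) then g x else v x).
    move=> x y Uxy; case: pselect => [_|nU] /=; first exact: gU.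
    by case: nU; exists y.
  apply/phiP; move/phiP: vq; apply: (iffLR (Sphi _ _ _ _)).
  move=> [x|//] /set_mem Sx /=; case: pselect => [[y Uxy] /=|//].
  by apply: Gv; apply: sG; split=> //=; split=> //; rewrite (gU _ _ Uxy).
have [tot|/existsNP[x nx]] := pselect (forall x, exists y, G (x, y)).
  have [v vG] := choice tot; exists v => phi pphi.
  have [||v' Gv' v'q] := Gq [set phi]; first exact: finite_set1.
    by move=> _ ->.
  by rewrite (_ : v = v'); [exact: v'q|apply/funext => y; rewrite (Gv' y _ (vG y))].
exfalso.
have [g gG] : {g : V -> M & forall x y, G (x, y) -> g x = y}.
  apply: (@choice _ _ (fun x z => forall y, G (x, y) -> z = y)) => z.
  have [[y Uy]|nU] := pselect (exists y, G (z, y)).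
    by exists y => y' Uy'; apply: Gf Uy Uy'.
  by exists m0 => y Uy; case: nU; exists y.
pose A := range (tcat g u).
have sA : small K A by apply: small_range; exact (small_sum hK sV sP).
have gA t : tcat g u t \in A by apply/mem_set; exists t.
pose c t : A := exist (fun y => y \in A) _ (gA t).
(* The 1-type for the value at [x]: formulas equivalent to the solvability, along [G], of a finite
   part of [p]. *)
pose p1 := [set chi : formula L (unit + A) | exists q, [/\ finite_set q, q `<=` p &
  forall b : unit -> M, sat (tcat b (set_val : A -> M)) chi <->
    exists v : V -> M,
      [/\ extends G v, v x = b tt & realizes (tcat v u) q]]].
have p1q q : finite_set q -> q `<=` p -> exists2 chi, p1 chi &
    forall b : unit -> M, sat (tcat b (set_val : A -> M)) chi <->
      exists v : V -> M, [/\ extends G v, v x = b tt & realizes (tcat v u) q].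
  move=> qfin qp; have [phi phiP] := finite_conj qfin.
  (* [x] becomes the free variable, assigned variables and entries of [u] become parameters from
     [A], and the remaining variables are bound by [ex_close]. *)
  pose r (t : V + P) : (unit + A) + V := match t with
    | inl y => if pselect (y = x) then inl (inl tt)
               else if pselect (exists z, G (y, z)) then inl (inr (c (inl y)))
               else inr y
    | inr z => inl (inr (c (inr z))) end.
  have [chi chiP] := ex_close (frename r phi).
  suff e : forall b : unit -> M, sat (tcat b (set_val : A -> M)) chi <->
      exists v : V -> M, [/\ extends G v, v x = b tt & realizes (tcat v u) q].
    by exists chi => //; exists q.
  move=> b; rewrite chiP; split=> [[w /sat_frename h]|[v [Gv vb vq]]].
    exists (fun y => tcat (tcat b (set_val : A -> M)) w (r (inl y))); split.
    - move=> y z Gyz /=; case: pselect => [yx|yx] /=.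
        by case: nx; exists z; rewrite -yx.
      case: pselect => [_|nG] /=; first exact: gG.
      by case: nG; exists z.
    - by move=> /=; case: pselect.
    - apply/phiP; move: h; rewrite (_ : _ \o r = tcat (fun y =>
        tcat (tcat b (set_val : A -> M)) w (r (inl y))) u)//.
      by apply/funext => -[].
  exists v; apply/sat_frename; move/phiP: vq.
  rewrite (_ : tcat v u = tcat (tcat b (set_val : A -> M)) v \o r)//.
  apply/funext => -[y|//] /=; case: pselect => [yx|yx] /=; first by rewrite yx.
  by case: pselect => [[z Gyz]|//] /=; rewrite (Gv _ _ Gyz) -(gG _ _ Gyz).
have [||b bp1] := @hsat A p1 => //.
  move=> q1 q1fin q1p.
  have /choice[Q QP] chi : exists q, q1 chi -> [/\ finite_set q, q `<=` p &
      forall b : unit -> M, sat (tcat b (set_val : A -> M)) chi <->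
      exists v : V -> M, [/\ extends G v, v x = b tt & realizes (tcat v u) q]].
    have [/q1p[q]|nq1] := pselect (q1 chi); first by exists q.
    by exists set0.
  have [||v Gv vq] := Gq (\bigcup_(chi in q1) Q chi).
  - by apply: bigcup_finite => // chi /QP[].
  - by move=> phi [chi /QP[_ + _]]; apply.
  exists (fun=> v x) => chi q1chi; have [_ _ ->] := QP _ q1chi.
  by exists v; split=> // phi Qphi; apply: vq; exists chi.
apply: (Gmax (G `|` [set (x, b tt)])).
  split; first by move=> t; left.
  by move=> GG; apply: nx; exists (b tt); apply: GG; right.
split.
- move=> y z z' [Gz|[ey ez]] [Gz'|[ey' ez']].
  + exact: Gf Gz Gz'.
  + by case: nx; exists z; rewrite -ey'.
  + by case: nx; exists z'; rewrite -ey.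
  + by rewrite ez ez'.
- move=> q qfin qp; have [chi p1chi chiP] := p1q q qfin qp.
  have /chiP[v [Gv vx vq]] := bp1 _ p1chi.
  by exists v => // y z [/Gv //|[-> ->]].
Qed.

(** Type-definability without parameters; parameters enter as extra coordinates of the tuple. *)
Definition tdef V (X : set (V -> M)) :=
  exists p : set (formula L V), forall v, X v <-> realizes v p.

Lemma tdef_eq V (X Y : set (V -> M)) : (forall v, X v <-> Y v) ->
  tdef X -> tdef Y.
Proof. by move=> XY [p pX]; exists p => v; rewrite -XY. Qed.

Lemma tdef_sat V phi : tdef [set v : V -> M | sat v phi].
Proof. by exists [set phi] => v; split=> [vp _ ->//|]; apply. Qed.

Lemma tdef_realizes V p : tdef [set v : V -> M | realizes v p].
Proof. by exists p. Qed.

Lemma tdef_forall D V (X : D -> set (V -> M)) : (forall i, tdef (X i)) ->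
  tdef [set v | forall i, X i v].
Proof.
move=> /choice[p pX]; exists (\bigcup_i p i) => v; split.
  by move=> Xv phi [i _ piphi]; apply: (iffLR (pX i v)).
by move=> vp i; apply/pX => phi piphi; apply: vp; exists i.
Qed.

Lemma tdef_and V (X Y : set (V -> M)) : tdef X -> tdef Y ->
  tdef [set v | X v /\ Y v].
Proof.
by move=> [p pX] [q qY]; exists (p `|` q) => v; rewrite realizesU -pX -qY.
Qed.

Lemma tdef_pre V W (r : V -> W) (X : set (V -> M)) : tdef X ->
  tdef [set v : W -> M | X (v \o r)].
Proof.
move=> [p pX]; exists (frename r @` p) => v /=; rewrite pX; split.
  by move=> vp _ [phi pphi <-]; apply/sat_frename/vp.
by move=> vp phi pphi; apply/sat_frename/vp; exists phi.
Qed.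

Lemma tdef_tde V W (F : tdequiv M V) (r r' : V -> W) :
  tdef [set v : W -> M | F (v \o r) (v \o r')].
Proof.
have := tdef_pre (tcat r r') (tdef_realizes (tde_type F)).
by apply: tdef_eq => v /=; rewrite tcat_comp.
Qed.

(** One inclusion suffices, because a type contains the negation of each formula that it omits. *)
Lemma tp_eqP V (v w : V -> M) : tp v = tp w <-> forall phi, sat v phi -> sat w phi.
Proof.
split=> [e phi|h]; first by rewrite -[sat v phi]/(tp v phi) e.
apply/seteqP; split=> phi /=; first exact: h.
by move=> wp; apply: contrapT => nv; exact: (h (Neg phi) nv wp).
Qed.

Lemma tp_comp V W (r : V -> W) (v w : W -> M) : tp v = tp w ->
  tp (v \o r) = tp (w \o r).
Proof.
move=> /tp_eqP vw; apply/tp_eqP => phi /sat_frename/vw h.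
exact/sat_frename.
Qed.

Lemma tdef_tp V W (r : V -> W) (v0 : V -> M) :
  tdef [set v : W -> M | tp (v \o r) = tp v0].
Proof.
have := tdef_pre r (tdef_realizes (tp v0)).
by apply: tdef_eq => v /=; split=> [h|<- //]; exact/esym/tp_eqP.
Qed.

Lemma tdef_tp2 V W (r r' : V -> W) :
  tdef [set v : W -> M | tp (v \o r) = tp (v \o r')].
Proof.
have := tdef_forall (fun phi => tdef_sat (Imp (frename r phi) (frename r' phi))).
apply: tdef_eq => v; split=> [h|/tp_eqP h phi].
  by apply/tp_eqP => phi /sat_frename hr; apply/sat_frename/(h phi).
by move=> /sat_frename/(h phi) hr; apply/sat_frename.
Qed.

(** The projection is defined by all formulas that hold on it. If [v] satisfies them, each finite
    part of [p] is solvable over [v], since its existential closure is among them, and compactness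
    yields a full solution. *)
Lemma tdef_ex V W (X : set (V + W -> M)) : small K V -> small K W ->
  tdef X -> tdef [set v | exists w, X (tcat v w)].
Proof.
move=> sV sW [p pX].
pose Y := [set v | exists w, X (tcat v w)].
exists [set phi | forall v, Y v -> sat v phi] => v; split.
  by move=> Yv phi; apply.
move=> vY.
pose r (t : V + W) : W + V := match t with inl x => inr x | inr y => inl y end.
have e w : tcat w v \o r = tcat v w by apply/funext => -[].
have [w wp] : exists w, realizes (tcat w v) (frename r @` p).
  apply: compactness => // q qfin qp.
  have [phi phiP] := finite_conj qfin.
  pose r' (t : W + V) : V + W := match t with inl x => inr x | inr y => inl y end.
  have e' w' v' : tcat v' w' \o r' = tcat w' v' by apply/funext => -[].
  have [psi psiP] := ex_close (frename r' phi).
  have /psiP[w /sat_frename] : sat v psi.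
    apply: vY => v' [w /pX h]; apply/psiP; exists w; apply/sat_frename.
    rewrite e'; apply/phiP => chi /qp[chi' pchi' <-]; apply/sat_frename.
    rewrite (_ : _ \o r = tcat v' w); first exact: h.
    by apply/funext => -[].
  by rewrite e' => /phiP h; exists w.
exists w; apply/pX => phi pphi; rewrite -e; apply/sat_frename; apply: wp.
by exists phi.
Qed.

Lemma tdef_aut V (X : set (V -> M)) (f : aut M) v : tdef X ->
  X (f \o v) <-> X v.
Proof. by move=> [p pX]; rewrite !pX realizes_aut. Qed.

Lemma tdef_compact D V P (u : P -> M) (X : D -> set (V + P -> M)) :
  small K V -> small K P -> (forall i, tdef (X i)) ->
  (forall s, finite_set s -> exists v, forall i, s i -> X i (tcat v u)) ->
  exists v, forall i, X i (tcat v u).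
Proof.
move=> sV sP /choice[p pX] fip.
suff [v vp] : exists v, realizes (tcat v u) (\bigcup_i p i).
  by exists v => i; apply/pX => phi pphi; apply: vp; exists i.
apply: compactness => // q qfin qp.
have [D0|D0] := pselect (inhabited D); last first.
  have [v _] := fip _ (finite_set0 D); exists v => phi /qp[i].
  by case: D0; constructor.
have [i0] := D0.
have /choice[i iP] phi : exists i, q phi -> p i phi.
  have [/qp[i _ ?]|nq] := pselect (q phi); first by exists i.
  by exists i0.
have [v vX] := fip _ (finite_image i qfin); exists v => phi qphi.
by have /pX := vX _ (imageP i qphi); apply; exact: iP.
Qed.

Lemma finite_nat_bounded (s : set nat) : finite_set s ->
  exists n, forall m, s m -> (m <= n)%N.
Proof.
move=> /finite_seqP[t ->]; exists (\max_(i <- t) i) => m mt.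
exact: leq_bigmax_seq.
Qed.

Lemma tdef_compact_nat V P (u : P -> M) (X : nat -> set (V + P -> M)) :
  small K V -> small K P -> (forall n, tdef (X n)) ->
  (forall n, exists v, forall m, (m <= n)%N -> X m (tcat v u)) ->
  exists v, forall n, X n (tcat v u).
Proof.
move=> sV sP tX fip; apply: tdef_compact => // s sfin.
have [n sn] := finite_nat_bounded sfin.
by have [v vX] := fip n; exists v => m /sn; exact: vX.
Qed.

End Compactness.

(** * Small models and coheirs *)

Definition tarski_vaught L (M : structure L) (A : set M) : Prop :=
  forall V (v : V -> M) (phi : formula L (option V)), (forall i, A (v i)) ->
    (exists x, sat (oapp v x) phi) -> exists2 x, A x & sat (oapp v x) phi.

Section Elementary.
Variables (L : language) (M : structure L).

Lemma elementaryP (A : set M) :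
  elementary_substructure A <-> tarski_vaught A.
Proof.
split=> [[A0 [AF el]] V v phi vA /sat_Ex exphi|tv].
  pose v' i : substructure A0 AF := exist (fun x => x \in A) (v i) (mem_set (vA i)).
  have /sat_Ex[x /el] : sat v' (Ex phi) by apply/el.
  rewrite (_ : _ \o _ = oapp v (set_val x)); first last.
    by apply/funext => -[].
  by exists (set_val x) => //; exact: set_valP.
have A0 : A !=set0.
  have [//||x Ax _] := tv _ (of_void M) (Eq (Var L None) (Var L None)).
  - by case: (carrier_nonempty M) => x; exists x.
  - by exists x.
have AF : fun_closed A.
  move=> f v; apply/mem_set.
  have [i||x Ax /= -> //] := tv _ (set_val \o v)
    (Eq (App (fun i => Var L (Some i))) (Var L None)).
  - exact: set_valP.
  - by exists (fun_interp f (set_val \o v)).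
exists A0, AF.
have evalE V (v : V -> substructure A0 AF) t :
    set_val (eval v t) = eval ((set_val : A -> M) \o v) t.
  elim: t => //= f ts IH; congr fun_interp; apply/funext => i; exact: IH.
move=> V v phi; elim: phi v => {}V.
- by [].
- move=> t u v /=; rewrite -!evalE; split=> [-> //|]; exact: val_inj.
- move=> s ts v /=.
  by rewrite (_ : (fun i => _) = set_val \o (fun i => eval v (ts i)))//;
    apply/funext => i; rewrite -evalE.
- by move=> phi IHp psi IHq v /=; rewrite IHp IHq.
- move=> phi IH v /=.
  have e (x : substructure A0 AF) :
      sat (oapp v x) phi <-> sat (oapp ((set_val : A -> M) \o v) (set_val x)) phi.
    by rewrite IH (_ : _ \o _ = oapp ((set_val : A -> M) \o v) (set_val x))//;
      apply/funext => -[].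
  split=> h x; last exact/e.
  apply: contrapT => nx.
  have [i||y Ay] := tv _ ((set_val : A -> M) \o v) (Neg phi).
  - exact: set_valP.
  - by exists x.
  - by move=> ny; apply: ny; apply: (iffLR (e (exist _ y (mem_set Ay)))); exact: h.
Qed.

Lemma elementary_aut (f : aut M) (A : set M) :
  elementary_substructure A -> elementary_substructure (f @` A).
Proof.
move=> /elementaryP tv; apply/elementaryP => V v phi vA [x xphi].
have e y : oapp v y = f \o oapp (aut_inv f \o v) (aut_inv f y).
  by apply/funext => -[i|] /=; rewrite aut_invK.
have [i||y Ay yphi] := tv _ (aut_inv f \o v) phi.
- by have [y Ay yv] := vA i; rewrite /= -yv aut_funK.
- by exists (aut_inv f x); move: xphi; rewrite e sat_aut.
- by exists (f y); [exists y|rewrite e sat_aut aut_funK].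
Qed.

End Elementary.

Section SmallModels.
Variables (K : Type) (L : language) (M : structure L).
Hypothesis hK : small K (formula L nat).

(** The Skolem hull of [B] passes the Tarski-Vaught test, and its elements are values of finite
    words over a small alphabet. *)
Lemma lowenheim_skolem (B : set M) : small K B ->
  exists A : set M, [/\ elementary_substructure A, small K A & B `<=` A].
Proof.
move=> sB; have [m0] := carrier_nonempty M.
have [w wP] : {w : formula L nat * seq M -> M & forall p,
    (exists x, sat (nth m0 (x :: p.2)) p.1) -> sat (nth m0 (w p :: p.2)) p.1}.
  apply: (@choice _ _ (fun p y =>
    (exists x, sat (nth m0 (x :: p.2)) p.1) -> sat (nth m0 (y :: p.2)) p.1)).
  move=> p; have [[x px]|np] := pselect (exists x, sat (nth m0 (x :: p.2)) p.1).
    by exists x.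
  by exists m0.
(* Skolem terms over [B] in reverse Polish notation; a token [inr (phi, n)]
   applies the Skolem function of [phi] to the top [n] entries of the stack. *)
pose tok := (B + formula L nat * nat)%type.
pose step (st : seq M) (t : tok) : seq M := match t with
  | inl b => set_val b :: st
  | inr (phi, n) => w (phi, take n st) :: drop n st end.
pose A := [set x | exists s : seq tok, forall st, foldl step st s = x :: st].
exists A; split.
- apply/elementaryP => V v phi vA [x xphi].
  have [S Sfin Sphi] := sat_support phi.
  have /(@finite_seqP {classic V})[vs vsE] : finite_set (Some @^-1` S).
    by apply: finite_preimage => // y z _ _ [].
  (* Any formula is brought to variables in [nat]: 0 is the witness, and k+1 the k-th entry of
     [vs]. *)
  pose r (t : option V) : nat :=
    if t is Some y then (index (y : {classic V}) vs).+1 else 0.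
  pose l := map (v : {classic V} -> M) vs.
  have e y : sat (nth m0 (y :: l)) (frename r phi) <-> sat (oapp v y) phi.
    rewrite sat_frename; apply: Sphi => -[z|//] /set_mem Sz /=.
    have zs : (z : {classic V}) \in vs.
      by have : [set` vs] z by rewrite -vsE.
    by rewrite (nth_map (z : {classic V})) ?index_mem// nth_index.
  have /e h := wP (frename r phi, l) (ex_intro _ x (iffRL (e x) xphi)).
  eexists; last exact: h.
  have [s sl] : exists s : seq tok, forall st, foldl step st s = l ++ st.
    rewrite /l; elim: (vs) => [|y ys [s sP]]; first by exists [::].
    have [s' s'P] := vA y; exists (s ++ s') => st.
    by rewrite foldl_cat sP s'P.
  exists (rcons s (inr (frename r phi, size l))) => st.
  by rewrite -cats1 foldl_cat sl /= take_size_cat// drop_size_cat.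
- have [c cP] : {c : A -> seq tok & forall x st, foldl step st (c x) = val x :: st}.
    apply: (@choice _ _ (fun x s => forall st, foldl step st s = val x :: st)).
    by case=> x /= /set_mem.
  apply: (@small_inj _ _ _ c).
    move=> x y cxy; apply: val_inj.
    by have := cP x [::]; rewrite cxy cP => -[].
  exact (small_seq hK (small_sum hK sB (small_prod hK hK (small_nat hK)))).
- move=> x /mem_set Bx; exists [:: inl (exist (fun y => y \in B) x Bx)] => st.
  by [].
Qed.

Variables (I : Type) (E : tdequiv M I) (a : I -> M).

Lemma small_model_exists (B : set M) : small K I -> small K B ->
  exists A, [/\ small_model K E a A, range a `<=` A & B `<=` A].
Proof.
move=> sI sB.
have [|A [elA sA BA]] := @lowenheim_skolem (range a `|` B).
  exact (small_setU hK (small_range a sI) sB).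
exists A; split; [split=> //|by move=> x ax; apply: BA; left|].
  move=> f fA; rewrite (_ : f \o a = a); first exact: tde_refl.
  by apply/funext => i; apply: fA; apply: BA; left; exists i.
by move=> x Bx; apply: BA; right.
Qed.

End SmallModels.

(** * Average types of ultrafilters and coheirs *)

Section Ultra.
Variables (K : Type) (L : language) (M : structure L).
Hypothesis hK : small K (formula L nat).
Hypothesis hsat : saturated K M.

Lemma filter_realized J P (U : set_system (J -> M)) (u : P -> M)
    (q : set (formula L (J + P))) : ProperFilter U ->
  small K J -> small K P ->
  (forall phi, q phi -> U [set v | sat (tcat v u) phi]) ->
  exists v, realizes (tcat v u) q.
Proof.
move=> PF sJ sP Uq; apply: (compactness hK hsat) => // q' q'fin q'q.
suff h : U [set v | realizes (tcat v u) q'] by have [v] := filter_ex h; exists v.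
have : q' `<=` q by [].
have /finite_seqP[s ->] := q'fin; elim: s {q'fin q'q} => [|phi s IHs] sq.
  by apply: filterS filterT => v _ phi.
have phiU : U [set v | sat (tcat v u) phi] by apply/Uq/sq; rewrite /= inE eqxx.
apply: filterS (filterI phiU (IHs _)) => [v [vphi vs] psi|].
  by rewrite /= inE => /orP[/eqP -> //|]; exact: vs.
by move=> psi psis; apply: sq; rewrite /= inE; apply/orP; right.
Qed.

(** The average type of [U] over [u]. Letting [u] vary gives a global type, finitely satisfiable in
    [N] when [U] concentrates on tuples of [N]. *)
Definition ultra_type J P (U : set_system (J -> M)) (u : P -> M) :
    set (formula L (J + P)) :=
  [set phi | U [set v | sat (tcat v u) phi]].

Lemma ultra_type_realized J P (U : set_system (J -> M)) (u : P -> M) :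
  UltraFilter U -> small K J -> small K P ->
  exists v, tp (tcat v u) = ultra_type U u.
Proof.
move=> UU sJ sP.
have [//|v vU] := @filter_realized _ _ U u (ultra_type U u) _ sJ sP.
exists v; apply/seteqP; split=> phi /=; last exact: vU.
move=> vphi; have [//|Un] := in_ultra_setVsetC [set v | sat (tcat v u) phi] UU.
by case: (vU (Neg phi) Un vphi).
Qed.

Lemma ultra_type_rename J P Q (U : set_system (J -> M)) (u : P -> M)
    (r : Q -> P) v : tp (tcat v u) = ultra_type U u ->
  tp (tcat v (u \o r)) = ultra_type U (u \o r).
Proof.
pose r' (t : J + Q) : J + P := match t with inl j => inl j | inr q => inr (r q) end.
have e w : tcat w (u \o r) = tcat w u \o r' by apply/funext => -[].
have eU phi : [set w | sat (tcat w (u \o r)) phi] =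
    [set w | sat (tcat w u) (frename r' phi)].
  by apply/seteqP; split=> w /=; rewrite sat_frename e.
have e' phi : tp (tcat v (u \o r)) phi <-> tp (tcat v u) (frename r' phi).
  by rewrite /tp /= sat_frename e.
move=> vU; apply/seteqP; split=> phi.
  by move=> /e'; rewrite vU /ultra_type /= eU.
by rewrite /ultra_type /= eU => h; apply/e'; rewrite vU.
Qed.

(** For [v] in [N], the truth of [phi] at [v], [u] depends only on the type of [u] over [N], so
    types finitely satisfiable in [N] are [N]-invariant. *)
Lemma ultra_type_invariant J P (U : set_system (J -> M)) (N : set M)
    (u u' : P -> M) : Filter U -> U [set v | forall j, N (v j)] ->
  tp (tcat u (set_val : N -> M)) = tp (tcat u' (set_val : N -> M)) ->
  ultra_type U u = ultra_type U u'.
Proof.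
have half w w' : Filter U -> U [set v | forall j, N (v j)] ->
    tp (tcat w (set_val : N -> M)) = tp (tcat w' (set_val : N -> M)) ->
    ultra_type (P := P) U w `<=` ultra_type U w'.
  move=> FU UN ww' phi; rewrite /ultra_type /= => Uphi.
  apply: filterS (filterI UN Uphi) => v [vN vphi] /=.
  pose r (t : J + P) : P + N := match t with
    | inl j => inr (exist (fun y => y \in N) (v j) (mem_set (vN j)))
    | inr p => inl p end.
  have e z : tcat v z = tcat z (set_val : N -> M) \o r by apply/funext => -[].
  rewrite e; apply/sat_frename; move: vphi; rewrite /= e => /sat_frename.
  by move/tp_eqP: ww'; apply.
by move=> FU UN uu'; apply/seteqP; split; exact: half.
Qed.

(** The solution sets in [N] of the formulas in tp(b/N) generate a filter, proper because [N] is
    elementary; any ultrafilter above it works. *)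
Lemma coheir J (N : set M) (b : J -> M) : elementary_substructure N ->
  exists U : set_system (J -> M), [/\ UltraFilter U,
    U [set v | forall j, N (v j)] &
    tp (tcat b (set_val : N -> M)) = ultra_type U (set_val : N -> M)].
Proof.
move=> [N0 [NF el]]; pose n : N -> M := set_val.
pose F : set_system (J -> M) := [set S | exists2 phi, sat (tcat b n) phi &
  forall v, (forall j, N (v j)) -> sat (tcat v n) phi -> S v].
have FF : ProperFilter F.
  split; first last; first split.
  - by exists (Neg Bot) => // h.
  - move=> S T [phi bphi phiS] [psi bpsi psiT]; exists (And phi psi).
      exact/sat_And.
    by move=> v vN /sat_And[vphi vpsi]; split; [exact: phiS|exact: psiT].
  - by move=> S T ST [phi bphi phiS]; exists phi => // v vN /(phiS _ vN)/ST.
  move=> [phi bphi nphi].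
  pose r (t : J + N) : N + J := match t with inl j => inr j | inr i => inl i end.
  have e (S : structure L) (v : J -> S) (w : N -> S) : tcat w v \o r = tcat v w.
    by apply/funext => -[].
  have [psi psiP] := ex_close (frename r phi).
  have : sat n psi by apply/psiP; exists b; apply/sat_frename; rewrite e.
  pose iN : N -> substructure N0 NF := id.
  rewrite -[n]/((set_val : N -> M) \o iN) -el => /psiP[v /sat_frename].
  rewrite e el => h; apply: (nphi ((set_val : N -> M) \o v)).
    by move=> j; exact: set_valP.
  move: h; rewrite (_ : _ \o _ = tcat ((set_val : N -> M) \o v) n)//.
  by apply/funext => -[].
have [U [UU FU]] := ultraFilterLemma FF; exists U; split=> //.
  by apply: FU; exists (Neg Bot) => // h.
apply/seteqP; split=> phi; first by move=> bphi; apply: FU; exists phi.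
rewrite /ultra_type /= => Uphi; apply: contrapT => nphi.
have : U (~` [set v | sat (tcat v n) phi]) by apply: FU; exists (Neg phi).
by move=> /(filterI Uphi); rewrite setICr; exact: filter_not_empty.
Qed.

End Ultra.

(** * Products of elementary strong automorphisms *)

Section Automorphisms.
Variables (L : language) (M : structure L).

Lemma autM (f g : aut M) : aut_fun (f * g)%g = f \o g.
Proof. exact: aut_compE. Qed.

Lemma aut1 : aut_fun (1%g : aut M) = id.
Proof. by []. Qed.

Lemma autK (f : aut M) V (v : V -> M) : (f^-1)%g \o (f \o v) = v.
Proof. by apply/funext => x /=; rewrite aut_funK. Qed.

Lemma autVK (f : aut M) V (v : V -> M) : f \o ((f^-1)%g \o v) = v.
Proof. by apply/funext => x /=; rewrite aut_invK. Qed.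

Lemma tp_aut (f : aut M) V (v : V -> M) : tp (f \o v) = tp v.
Proof. by apply/tp_eqP => phi; rewrite sat_aut. Qed.

Lemma tde_aut J (F : tdequiv M J) (f : aut M) (b c : J -> M) :
  F (f \o b) (f \o c) <-> F b c.
Proof. by rewrite /tde_rel -tcat_comp realizes_aut. Qed.

Lemma tde_autl J (F : tdequiv M J) (f : aut M) (b c : J -> M) :
  F (f \o b) c <-> F b ((f^-1)%g \o c).
Proof. by rewrite -{1}(autVK f c) tde_aut. Qed.

Variables (I : Type) (E : tdequiv M I) (a : I -> M).

Lemma Aute_1 : Aute E a 1%g.
Proof. exact: tde_refl. Qed.

Lemma Aute_V f : Aute E a f -> Aute E a (f^-1)%g.
Proof. by move=> /tde_autl; exact: tde_sym. Qed.

Lemma Aute_M f g : Aute E a f -> Aute E a g -> Aute E a (f * g)%g.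
Proof.
move=> fe ge; rewrite /Aute /= autM; apply: tde_trans fe.
by rewrite -[(f \o g) \o a]/(f \o (g \o a)); apply/tde_aut.
Qed.

End Automorphisms.

(** The generators of [Autfe]; membership in [Aute] is left out because it follows from e in
    dcl(A). *)
Definition strong_gen K L (M : structure L) I (E : tdequiv M I) (a : I -> M) :
    set (aut M) :=
  [set h | exists2 A, small_model K E a A & fixes h A].

Arguments strong_gen K {L M I} E a.

Fixpoint strong_pow K L (M : structure L) I (E : tdequiv M I) (a : I -> M) n :
    set (aut M) :=
  if n is n'.+1 then [set f | exists h g,
    [/\ strong_gen K E a h, strong_pow K E a n' g & f = (h * g)%g]]
  else [set 1%g].

Arguments strong_pow K {L M I} E a n.

(** Given as a chain of single steps, rather than through [strong_pow], so that type-definability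
    can be proved by induction on [n]; [strong_dist_pow] shows that both descriptions agree. *)
Fixpoint strong_dist K L (M : structure L) I (E : tdequiv M I) (a : I -> M)
    J (F : tdequiv M J) n (b c : J -> M) : Prop :=
  if n is n'.+1 then exists x h, [/\ strong_dist K E a F n' b x,
    strong_gen K E a h & F (h \o x) c]
  else F b c.

Arguments strong_dist K {L M I} E a {J} F n b c.

Section Strong.
Variables (K : Type) (L : language) (M : structure L).
Variables (I : Type) (E : tdequiv M I) (a : I -> M).
Hypothesis hK : small K (formula L nat).
Hypothesis sI : small K I.

Let gen := strong_gen K E a.
Let pow := strong_pow K E a.

Lemma small_model_aut (g : aut M) A : Aute E a g -> small_model K E a A ->
  small_model K E a (g @` A).
Proof.
move=> ge [elA sA dA]; split; first exact: elementary_aut.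
  have gA (y : g @` A) : (g^-1)%g (val y) \in A.
    by apply/mem_set; case: y => y /= /set_mem[x Ax <-]; rewrite aut_funK.
  apply: (@small_inj _ _ _ (fun y => exist (fun x => x \in A) _ (gA y))) sA.
  by move=> x y [/(can_inj (@aut_invK _ _ g))]; exact: val_inj.
(* For e in dcl(g(A)): the conjugate of [f] by [g] fixes [A] pointwise. *)
move=> f fgA; have : E (((g^-1)%g * (f * g))%g \o a) a.
  by apply: dA => x Ax; rewrite !autM /= fgA ?aut_funK//; exists x.
rewrite !autM => h.
have {}h : E (f \o (g \o a)) (g \o a).
  by apply/(tde_aut _ (g^-1)%g); rewrite autK.
apply: tde_trans (ge); apply: tde_trans h; apply/tde_aut.
exact: tde_sym ge.
Qed.

Lemma strong_gen_Aute h : gen h -> Aute E a h.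
Proof. by move=> [A [_ _ dA] hA]; exact: dA. Qed.

Lemma strong_genV h : gen h -> gen (h^-1)%g.
Proof.
move=> [A mA hA]; exists A => // x Ax.
by rewrite -{1}(hA x Ax); exact: aut_funK.
Qed.

Lemma strong_gen1 : gen 1%g.
Proof.
have [|A [mA _ _]] := @small_model_exists K L M hK I E a set0 sI.
  by apply: (@small_inj _ _ _ (fun=> 0)) (small_nat hK) => x; case: (set_valP x).
by exists A.
Qed.

Lemma strong_genJ g h : Aute E a g -> gen h -> gen (g * h * g^-1)%g.
Proof.
move=> ge [A mA hA]; exists (g @` A); first exact: small_model_aut.
by move=> _ [x Ax <-]; rewrite !autM /= aut_funK hA.
Qed.

Lemma strong_pow_gen h : gen h -> pow 1 h.
Proof. by move=> gh; exists h, 1%g; split=> //; rewrite mulg1. Qed.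

Lemma strong_powM n m f g : pow n f -> pow m g -> pow (n + m) (f * g)%g.
Proof.
move=> + gm; elim: n f => [|n IHn] f; first by move=> ->; rewrite mul1g.
by move=> [h [k [gh /IHn kn ->]]]; exists h, (k * g)%g; split=> //; rewrite mulgA.
Qed.

Lemma strong_powV n f : pow n f -> pow n (f^-1)%g.
Proof.
elim: n f => [|n IHn] f; first by move=> ->; rewrite /pow /= invg1.
move=> [h [k [gh /IHn kn ->]]]; rewrite invgM -addn1.
by apply: strong_powM => //; apply/strong_pow_gen/strong_genV.
Qed.

(** The generators are closed under inverses, so their finite products already form a subgroup. *)
Lemma AutfeP f : Autfe K E a f <-> exists n, pow n f.
Proof.
split=> [|[n]].
  move/(_ [set f | exists n, pow n f]); apply; split; first split.
  - by apply/mem_set; exists 0.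
  - move=> g h /set_mem[n gn] /set_mem[m hm]; apply/mem_set; exists (n + m).
    by apply: strong_powM => //; exact: strong_powV.
  - by move=> g [_ gg]; exists 1; exact: strong_pow_gen.
have [S1 SB] := Autfe_subgroup K E a.
have inM := group_closedM (Autfe_subgroup K E a).
elim: n f => [|n IHn] f; first by move=> ->; exact: set_mem.
move=> [h [k [gh /IHn kn ->]]]; apply/set_mem/inM; apply/mem_set => //.
by move=> H [_ HH]; apply: HH; split=> //; exact: strong_gen_Aute.
Qed.

Lemma Autfe_gen f : gen f -> Autfe K E a f.
Proof. by move=> gf; apply/AutfeP; exists 1; exact: strong_pow_gen. Qed.

Lemma Autfe_1 : Autfe K E a 1%g.
Proof. by apply/AutfeP; exists 0. Qed.

Lemma Autfe_M f g : Autfe K E a f -> Autfe K E a g -> Autfe K E a (f * g)%g.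
Proof.
move=> /AutfeP[n fn] /AutfeP[m gm]; apply/AutfeP; exists (n + m).
exact: strong_powM.
Qed.

Lemma Autfe_V f : Autfe K E a f -> Autfe K E a (f^-1)%g.
Proof. by move=> /AutfeP[n fn]; apply/AutfeP; exists n; exact: strong_powV. Qed.

Lemma Autfe_Aute f : Autfe K E a f -> Aute E a f.
Proof.
move=> /AutfeP[n]; elim: n f => [|n IHn] f; first by move=> ->; exact: Aute_1.
by move=> [h [k [/strong_gen_Aute he /IHn ke ->]]]; exact: Aute_M.
Qed.

Lemma AutfeJ g f : Aute E a g -> Autfe K E a f -> Autfe K E a (g * f * g^-1)%g.
Proof.
move=> ge /AutfeP[n]; elim: n f => [|n IHn] f.
  by move=> ->; rewrite mulg1 mulgV; exact: Autfe_1.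
move=> [h [k [gh /IHn kn ->]]].
rewrite (_ : (g * (h * k) * g^-1 = (g * h * g^-1) * (g * k * g^-1))%g).
  by apply: Autfe_M (kn); apply: Autfe_gen; exact: strong_genJ.
by rewrite !mulgA mulgVK.
Qed.

Variables (J : Type) (F : tdequiv M J).
Let dist := strong_dist K E a F.

Lemma strong_dist_congr n b b' c c' : F b' b -> F c c' -> dist n b c -> dist n b' c'.
Proof.
elim: n b c c' => [|n IHn] b c c' bb' cc' /=.
  by move=> bc; apply: tde_trans cc'; exact: tde_trans bc.
move=> [x [h [bx gh xc]]]; exists x, h; split=> //; last exact: tde_trans cc'.
by apply: IHn bx => //; exact: tde_refl.
Qed.

Lemma strong_dist_trans n m b c d : dist n b c -> dist m c d -> dist (n + m) b d.
Proof.
move=> bc; elim: m d => [|m IHm] d /=.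
  by move=> cd; rewrite addn0; apply: strong_dist_congr bc => //; exact: tde_refl.
by rewrite addnS => -[x [h [/IHm bx gh xd]]]; exists x, h.
Qed.

Lemma strong_dist_gen b h c : gen h -> F (h \o b) c -> dist 1 b c.
Proof. by move=> gh bc; exists b, h; split=> //; exact: tde_refl. Qed.

Lemma strong_dist_sym n b c : dist n b c -> dist n c b.
Proof.
elim: n c => [|n IHn] c /=; first exact: tde_sym.
move=> [x [h [/IHn xb gh xc]]]; rewrite -addn1 addnC; apply: strong_dist_trans xb.
by apply: strong_dist_gen (strong_genV gh) _; apply: tde_sym; apply/tde_autl.
Qed.

Lemma strong_dist_mono n m b c : (n <= m)%N -> dist n b c -> dist m b c.
Proof.
move=> /subnK <-; elim: (m - n) => [//|k IHk] /IHk bc.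
exists c, 1%g; split; [exact: bc|exact: strong_gen1|].
by rewrite aut1; exact: tde_refl.
Qed.

Lemma strong_dist_aut n g b c : Aute E a g -> dist n b c -> dist n (g \o b) (g \o c).
Proof.
move=> ge; elim: n c => [|n IHn] c /=; first by move=> bc; apply/tde_aut.
move=> [x [h [/IHn bx gh xc]]]; exists (g \o x), (g * h * g^-1)%g.
split=> //; first exact: strong_genJ.
rewrite !autM (_ : _ \o _ = g \o (h \o x)); first exact/tde_aut.
by apply/funext => j /=; rewrite aut_funK.
Qed.

Lemma strong_dist_pow n b c : dist n b c <-> exists2 f, pow n f & F (f \o b) c.
Proof.
split.
  elim: n c => [|n IHn] c /=; first by move=> bc; exists 1%g.
  move=> [x [h [/IHn[f fn fb] gh hx]]]; exists (h * f)%g; first by exists h, f.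
  rewrite autM -[(h \o f) \o b]/(h \o (f \o b)).
  by apply: tde_trans hx; apply/tde_aut.
move=> [f fn fb]; apply: (strong_dist_congr _ fb); first exact: tde_refl.
elim: n f fn {c fb} => [|n IHn] f; first by move=> ->; rewrite aut1; exact: tde_refl.
move=> [h [k [gh /IHn kn ->]]]; exists (k \o b), h; split=> //.
by rewrite autM; exact: tde_refl.
Qed.

Lemma lascar_equivP b c : lascar_equiv K E a F b c <-> exists n, dist n b c.
Proof.
split=> [[f /AutfeP[n fn] fb]|[n /strong_dist_pow[f fn fb]]].
  by exists n; apply/strong_dist_pow; exists f.
by exists f => //; apply/AutfeP; exists n.
Qed.

Lemma lascar_equiv_sym b c : lascar_equiv K E a F b c ->
  lascar_equiv K E a F c b.
Proof.
by move=> /lascar_equivP[n bc]; apply/lascar_equivP; exists n; exact: strong_dist_sym.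
Qed.

End Strong.

(** * Type-definability of the strong distance *)

(** Colour [i] by the truth values of [P d i] for [d] in [s]: there are finitely many colours. *)
Lemma pigeonhole_seq (D : eqType) (s : seq D) (P : D -> nat -> Prop) :
  exists i j, (i < j)%N /\ forall d, d \in s -> P d i <-> P d j.
Proof.
pose c (i : nat) : (size s).-tuple bool := map_tuple (fun d => `[< P d i >]) (in_tuple s).
have [i [j [ij cij]]] : exists i j, (i < j)%N /\ c i = c j.
  apply: contrapT => nc.
  have : injective (fun i : 'I_(#|{: (size s).-tuple bool}|.+1) => c i).
    move=> i j cij; apply/val_inj; case: (ltngtP i j) => // ij.
      by case: nc; exists i, j.
    by case: nc; exists j, i.
  by move=> /leq_card; rewrite card_ord ltnn.
exists i, j; split=> // d ds.
have /eq_in_map/(_ d ds) /= e : map (fun d => `[< P d i >]) s =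
  map (fun d => `[< P d j >]) s by exact (congr1 (@tval _ _) cij).
by split=> /asboolP; [rewrite e|rewrite -e] => /asboolP.
Qed.

Section Closedness.
Variables (K : Type) (L : language) (M : structure L).
Variables (I : Type) (E : tdequiv M I) (a : I -> M).
Hypothesis hK : small K (formula L nat).
Hypothesis hsat : saturated K M.
Hypothesis hhom : strongly_homogeneous K M.
Hypothesis sI : small K I.
Variables (J : Type) (F : tdequiv M J).
Hypothesis sJ : small K J.
Let dist := strong_dist K E a F.

Lemma model_over : exists (A : set M) (r : I -> A),
  small_model K E a A /\ (set_val : A -> M) \o r = a.
Proof.
have s0 : small K (set0 : set M).
  by apply: (@small_inj _ _ _ (fun=> 0)) (small_nat hK) => x; case: (set_valP x).
have [A [mA aA _]] := small_model_exists hK E a sI s0.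
exists A, (fun i => exist (fun x => x \in A) (a i)
  (mem_set (aA _ (ex_intro2 _ _ i Logic.I erefl)))).
by split=> //; apply/funext.
Qed.

(** Trades the quantifier over all small models for one over copies [y] of a single fixed model, so
    that one step becomes a projection of a type-definable set. *)
Lemma strong_dist1P (A : set M) (r : I -> A) : small_model K E a A ->
  (set_val : A -> M) \o r = a -> forall b c : J -> M,
  dist 1 b c <-> exists (y : A -> M) (b' c' : J -> M),
    [/\ tp y = tp (set_val : A -> M), E (y \o r) a, F b' b, F c' c &
        tp (tcat y b') = tp (tcat y c')].
Proof.
move=> mA ra b c; have [elA sA dA] := mA; pose vA : A -> M := set_val.
split=> [[x [h [bx [N [elN sN dN] hN] hxc]]]|[y [b' [c' [yA ya b'b c'c bc]]]]].
  pose n : N -> M := set_val.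
  (* [y] realizes the coheir of tp(A/N) over [N], [x] and the image of [x]. Since [h] fixes [N],
     invariance of the coheir gives [x] and its image the same type over [y]. *)
  have [U [UU UN Ut]] := @coheir _ _ A N vA elN.
  have [|y yU] := @ultra_type_realized K L M hK hsat A _ U
    (tcat n (tcat x (h \o x))) UU sA.
    by apply: (small_sum hK) => //; exact: (small_sum hK).
  have yn : tp (tcat y n) = ultra_type U n.
    by have := ultra_type_rename inl yU.
  have [f fy] := hhom (small_sum hK sA sN) (etrans Ut (esym yn)).
  rewrite tcat_comp in fy.
  have fA : f \o vA = y by apply/funext => i; exact: (congr1 (fun g => g (inl i)) fy).
  have fn : f \o n = n by apply/funext => i; exact: (congr1 (fun g => g (inr i)) fy).
  exists y, x, (h \o x); split=> //.
  - by rewrite -fA tp_aut.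
  - rewrite -fA -compA ra; apply: dN => z /mem_set Nz.
    exact: (congr1 (fun g => g (exist _ z Nz)) fn).
  - exact: tde_sym.
  - have e1 : tp (tcat y x) = ultra_type U x.
      by have := ultra_type_rename (fun j => inr (inl j)) yU.
    have e2 : tp (tcat y (h \o x)) = ultra_type U (h \o x).
      by have := ultra_type_rename (fun j => inr (inr j)) yU.
    rewrite e1 e2; apply: (ultra_type_invariant (N := N)) => //.
    rewrite -(tp_aut h) tcat_comp; congr (tp (tcat _ _)).
    by apply/funext => i /=; rewrite hN//; exact: set_valP.
(* Conversely [y] enumerates the model f(A), and the automorphism [t] taking [b'] to [c'] fixes
   it. *)
have [f fy] := hhom sA (esym yA).
have [t tbc] := hhom (small_sum hK sA sJ) bc.
rewrite tcat_comp in tbc.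
have ty : t \o y = y by apply/funext => i; exact: (congr1 (fun g => g (inl i)) tbc).
have tb : t \o b' = c' by apply/funext => i; exact: (congr1 (fun g => g (inr i)) tbc).
exists b, t; split; first exact: tde_refl.
  exists (f @` A).
    apply: small_model_aut => //.
    by rewrite /Aute /= (_ : f \o a = y \o r)// -ra -fy.
  move=> _ [x /mem_set Ax <-]; have := congr1 (fun g => g (exist _ x Ax)) ty.
  by rewrite -fy.
by apply: tde_trans c'c; rewrite -tb; apply/tde_aut; exact: tde_sym.
Qed.

Lemma tdef_strong_dist n : exists2 X : set ((J + J) + I -> M), tdef X &
  forall b c, X (tcat (tcat b c) a) <-> dist n b c.
Proof.
have sV : small K ((J + J) + I).
  by apply: (small_sum hK) => //; exact: (small_sum hK).
have [X1 tX1 X1P] : exists2 X : set ((J + J) + I -> M), tdef X &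
    forall b c, X (tcat (tcat b c) a) <-> dist 1 b c.
  have [A [r [mA ra]]] := model_over; have [elA sA dA] := mA.
  (* [V] indexes (b, c, a), and [W] the witnesses (y, b', c') of [strong_dist1P]. *)
  pose W := (A + (J + J))%type; pose V := ((J + J) + I)%type.
  pose k1 (t : A + J) : V + W := match t with
    | inl x => inr (inl x) | inr j => inr (inr (inl j)) end.
  pose k2 (t : A + J) : V + W := match t with
    | inl x => inr (inl x) | inr j => inr (inr (inr j)) end.
  pose Y := [set v : V + W -> M |
    [/\ tp (v \o (inr \o inl)) = tp (set_val : A -> M),
        E (v \o (inr \o (inl \o r))) (v \o (inl \o inr)),
        F (v \o (inr \o (inr \o inl))) (v \o (inl \o (inl \o inl))),
        F (v \o (inr \o (inr \o inr))) (v \o (inl \o (inl \o inr))) &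
        tp (v \o k1) = tp (v \o k2)]].
  have tY : tdef Y.
    have := tdef_and (tdef_tp (inr \o inl : A -> V + W) (set_val : A -> M))
      (tdef_and (tdef_tde E (inr \o (inl \o r) : I -> V + W) (inl \o inr))
      (tdef_and (tdef_tde F (inr \o (inr \o inl) : J -> V + W) (inl \o (inl \o inl)))
      (tdef_and (tdef_tde F (inr \o (inr \o inr) : J -> V + W) (inl \o (inl \o inr)))
      (tdef_tp2 M k1 k2)))).
    by apply: tdef_eq => v; split=> [[? [? [? []]]]|[]].
  exists [set v | exists w, Y (tcat v w)].
    apply: (tdef_ex hK hsat) => //.
    by apply: (small_sum hK) => //; exact: (small_sum hK).
  move=> b c; rewrite (strong_dist1P mA ra) /=.
  split=> [[w [w1 w2 w3 w4 w5]]|[y [b' [c' [y1 y2 y3 y4 y5]]]]].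
    exists (w \o inl), (w \o (inr \o inl)), (w \o (inr \o inr)); split=> //.
    have e1 : tcat (w \o inl) (w \o (inr \o inl)) =
        tcat (tcat (tcat b c) a) w \o k1 by apply/funext => -[].
    have e2 : tcat (w \o inl) (w \o (inr \o inr)) =
        tcat (tcat (tcat b c) a) w \o k2 by apply/funext => -[].
    by rewrite e1 e2.
  exists (tcat y (tcat b' c')); split=> //.
  have e1 : tcat y b' = tcat (tcat (tcat b c) a) (tcat y (tcat b' c')) \o k1.
    by apply/funext => -[].
  have e2 : tcat y c' = tcat (tcat (tcat b c) a) (tcat y (tcat b' c')) \o k2.
    by apply/funext => -[].
  by rewrite -e1 -e2.
elim: n => [|n [Xn tXn XnP]].
  exists [set v : (J + J) + I -> M | F (v \o (inl \o inl)) (v \o (inl \o inr))] => //.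
  exact: tdef_tde.
pose V := ((J + J) + I)%type.
(* [k1] and [k2] read off (b, x, a) and (x, c, a), where [x] is reached after n steps. *)
pose k1 (t : V) : V + J := match t with
  | inl (inl j) => inl (inl (inl j)) | inl (inr j) => inr j
  | inr i => inl (inr i) end.
pose k2 (t : V) : V + J := match t with
  | inl (inl j) => inr j | inl (inr j) => inl (inl (inr j))
  | inr i => inl (inr i) end.
pose Y := [set v : V + J -> M | Xn (v \o k1) /\ X1 (v \o k2)].
exists [set v | exists x, Y (tcat v x)].
  by apply: (tdef_ex hK hsat) => //; apply: tdef_and; exact: tdef_pre.
move=> b c /=.
have YP x : Y (tcat (tcat (tcat b c) a) x) <-> dist n b x /\ dist 1 x c.
  rewrite -XnP -X1P /Y /=.
  have -> : tcat (tcat (tcat b c) a) x \o k1 = tcat (tcat b x) a.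
    by apply/funext => -[[]|].
  have -> // : tcat (tcat (tcat b c) a) x \o k2 = tcat (tcat x c) a.
  by apply/funext => -[[]|].
split=> [[x /YP[bx xc]]|[x [h [bx gh hxc]]]].
  by rewrite -[n.+1]addn1; exact: strong_dist_trans bx xc.
by exists x; apply/YP; split=> //; exact: strong_dist_gen hxc.
Qed.

(** By [strong_dist1P] and compactness it suffices to treat finitely many formulas. By the
    pigeonhole principle two terms [s i], [s j] agree on them over [A], and indiscernibility moves
    this pair to the classes of [s 0], [s 1], taking [A] to the required copy. *)
Lemma indiscernible_strong_dist (s : nat -> J -> M) : indiscernible E a F s ->
  dist 1 (s 0) (s 1).
Proof.
move=> ind; have [A [r [mA ra]]] := model_over; have [elA sA dA] := mA.
apply/(strong_dist1P mA ra).
pose W := (A + (J + J))%type; pose P := (I + (J + J))%type.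
pose k1 (t : A + J) : W + P := match t with
  | inl x => inl (inl x) | inr j => inl (inr (inl j)) end.
pose k2 (t : A + J) : W + P := match t with
  | inl x => inl (inl x) | inr j => inl (inr (inr j)) end.
pose Y phi := [set v : W + P -> M |
  [/\ tp (v \o (inl \o inl)) = tp (set_val : A -> M),
      E (v \o (inl \o (inl \o r))) (v \o (inr \o inl)),
      F (v \o (inl \o (inr \o inl))) (v \o (inr \o (inr \o inl))),
      F (v \o (inl \o (inr \o inr))) (v \o (inr \o (inr \o inr))) &
      sat v (Imp (frename k1 phi) (frename k2 phi))]].
have tY phi : tdef (Y phi).
  have := tdef_and (tdef_tp (inl \o inl : A -> W + P) (set_val : A -> M))
    (tdef_and (tdef_tde E (inl \o (inl \o r) : I -> W + P) (inr \o inl))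
    (tdef_and (tdef_tde F (inl \o (inr \o inl) : J -> W + P) (inr \o (inr \o inl)))
    (tdef_and (tdef_tde F (inl \o (inr \o inr) : J -> W + P) (inr \o (inr \o inr)))
    (tdef_sat M (Imp (frename k1 phi) (frename k2 phi)))))).
  by apply: tdef_eq => v; split=> [[? [? [? []]]]|[]].
have [||//|w wY] := tdef_compact hK hsat (u := tcat a (tcat (s 0) (s 1))) _ _ tY.
- by apply: (small_sum hK) => //; exact: (small_sum hK).
- by apply: (small_sum hK) => //; exact: (small_sum hK).
- move=> S /finite_seqP[t ->].
  pose P' (phi : formula L (A + J)) i := sat (tcat (set_val : A -> M) (s i)) phi.
  have [i [j [ij Pij]]] := pigeonhole_seq t P'.
  pose ix (k : 'I_2) := if k == ord0 then i else j.
  have [|f fe fs] := ind 1 ix.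
    by move=> [[|[|]]] // ? [[|[|]]].
  have /Aute_V ge := fe; set g := (f^-1)%g in ge.
  exists (tcat (g \o set_val) (tcat (g \o s i) (g \o s j))) => phi tphi.
  split=> //=.
  + exact (tp_aut g (set_val : A -> M)).
  + suff h : E (g \o ((set_val : A -> M) \o r)) a by exact h.
    by rewrite ra; exact: ge.
  + suff h : F (g \o s i) (s 0) by exact h.
    by apply/tde_sym; apply/(tde_autl F f); exact: (fs ord0).
  + suff h : F (g \o s j) (s 1) by exact h.
    by apply/tde_sym; apply/(tde_autl F f); exact: (fs ord_max).
  + rewrite !sat_frename.
    rewrite (_ : _ \o k1 = g \o tcat (set_val : A -> M) (s i)); last first.
      by rewrite tcat_comp; apply/funext => -[].
    rewrite (_ : _ \o k2 = g \o tcat (set_val : A -> M) (s j)); last first.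
      by rewrite tcat_comp; apply/funext => -[].
    by rewrite !sat_aut; apply: (iffLR (Pij _ _)).
(* The first four clauses do not depend on the index, so any formula yields them. *)
have [w1 w2 w3 w4 _] := wY Bot.
exists (w \o inl), (w \o (inr \o inl)), (w \o (inr \o inr)); split=> //.
apply/tp_eqP => phi h; have [_ _ _ _ /=] := wY phi; rewrite !sat_frename.
rewrite (_ : _ \o k1 = tcat (w \o inl) (w \o (inr \o inl))); last first.
  by apply/funext => -[].
by rewrite (_ : _ \o k2 = tcat (w \o inl) (w \o (inr \o inr)));
  [apply|apply/funext => -[]].
Qed.

Lemma lascar_dist_strong n b c : lascar_dist_le E a F n b c -> dist n b c.
Proof.
move=> [p [p0 pn ps]]; apply: (strong_dist_congr p0 pn).
suff : forall m, (m <= n)%N -> dist m (p 0) (p m) by apply.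
elim=> [_|m IHm mn]; first exact: tde_refl.
have [s [ind s0 s1]] := ps _ mn.
rewrite -[X in dist X]addn1; apply: strong_dist_trans (IHm (ltnW mn)) _.
by apply: (strong_dist_congr _ s1 (indiscernible_strong_dist ind)); exact: tde_sym.
Qed.

End Closedness.

(** * Morley sequences *)

Section EqTde.
Variables (L : language) (M : structure L) (J : Type).

Let eq_type : set (formula L (J + J)) :=
  range (fun j => Eq (Var L (inl j)) (Var L (inr j))).

Lemma realizes_eq (b c : J -> M) : realizes (tcat b c) eq_type <-> b = c.
Proof.
split=> [h|-> _ [j _ <-] //]; apply/funext => j.
by apply: (h (Eq (Var L (inl j)) (Var L (inr j)))); exists j.
Qed.

(** Lets real tuples, in particular enumerations of models, be treated as hyperimaginaries. *)
Definition eq_tde : tdequiv M J.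
Proof.
apply: (@Tdequiv _ _ _ eq_type).
- by move=> b; apply/realizes_eq.
- by move=> b c /realizes_eq ->; apply/realizes_eq.
- by move=> b c d /realizes_eq -> /realizes_eq ->; apply/realizes_eq.
Defined.

Lemma eq_tdeP (b c : J -> M) : eq_tde b c <-> b = c.
Proof. exact: realizes_eq. Qed.

End EqTde.

Definition incr_below k (i : nat -> nat) :=
  forall j l, (j < l)%N -> (l < k)%N -> (i j < i l)%N.

Definition decr_below k (i : nat -> nat) :=
  forall j l, (j < l)%N -> (l < k)%N -> (i l < i j)%N.

Section Morley.
Variables (K : Type) (L : language) (M : structure L).
Hypothesis hK : small K (formula L nat).
Hypothesis hsat : saturated K M.
Hypothesis hhom : strongly_homogeneous K M.
Variables (J : Type) (N : set M) (m0 : N).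
Hypotheses (sJ : small K J) (sN : small K N).

Let n : N -> M := set_val.

(* The default value is taken in [N], so that automorphisms over [N] commute
   with [trunc k]. *)
Definition trunc k (s : nat -> J -> M) (t : nat * J) : M :=
  if (t.1 < k)%N then s t.1 t.2 else n m0.

Definition indiscernible_over (s : nat -> J -> M) := forall k i,
  incr_below k i -> tp (tcat n (trunc k (s \o i))) = tp (tcat n (trunc k s)).

Definition morley U (s : nat -> J -> M) := forall k,
  tp (tcat (s k) (tcat n (trunc k s))) = ultra_type U (tcat n (trunc k s)).

Definition scons (x : J -> M) (s : nat -> J -> M) k :=
  if k is k'.+1 then s k' else x.

(** Induction on the length: the type of the next term over [N] and the earlier ones is given by
    [U], hence by invariance is determined by the type of the earlier terms over [N]. *)
Lemma morley_indiscernible U s : UltraFilter U ->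
  U [set v | forall j, N (v j)] -> morley U s -> indiscernible_over s.
Proof.
move=> UU UN mor; elim=> [|k IHk] i ik.
  by congr (tp (tcat _ _)); apply/funext => -[].
have {}IHk := IHk i (fun j l jl lk => ik j l jl (ltnW lk)).
pose r (t : N + nat * J) : J + (N + nat * J) := match t with
  | inl x => inr (inl x)
  | inr t => if t.1 == k then inl t.2 else inr (inr t) end.
have e s' : tcat n (trunc k.+1 s') = tcat (s' k) (tcat n (trunc k s')) \o r.
  apply/funext => -[//|[j x]] /=; rewrite /trunc /= ltnS leq_eqVlt.
  by case: eqP => [->//|_] /=.
rewrite !e; apply: tp_comp; rewrite mor.
(* [s (i k)] realizes the type of [U] over the first [i k] terms; [q] selects those with indices
   [i 0], ..., [i (k-1)], which are among them because [i] is increasing. *)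
pose q (t : N + nat * J) : N + nat * J := match t with
  | inl x => inl x
  | inr t => if (t.1 < k)%N then inr (i t.1, t.2) else inl m0 end.
have eq_q : tcat n (trunc k (s \o i)) = tcat n (trunc (i k) s) \o q.
  apply/funext => -[//|[j x]] /=; rewrite /trunc /=.
  by case: ltnP => //= jk; rewrite ik.
have := ultra_type_rename q (mor (i k)); rewrite -eq_q /= => ->.
apply: (ultra_type_invariant (N := N)) => //.
pose d (t : (N + nat * J) + N) : N + nat * J := match t with
  | inl t => t | inr x => inl x end.
have ed w : tcat (tcat n w) n = tcat n w \o d by apply/funext => -[].
by rewrite -/n !ed; exact: tp_comp.
Qed.

(** Each term of [s] realizes [U] over [N], the earlier terms and both [b] and [c], so one tail
    continues either starting point. *)
Lemma morley_exists U (b c : J -> M) : UltraFilter U ->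
  tp (tcat b n) = ultra_type U n -> tp (tcat c n) = ultra_type U n ->
  exists s, morley U (scons b s) /\ morley U (scons c s).
Proof.
move=> UU bU cU.
have [next nextP] : {next : (nat * J -> M) -> J -> M & forall w,
    tp (tcat (next w) (tcat (tcat n (tcat b c)) w)) =
    ultra_type U (tcat (tcat n (tcat b c)) w)}.
  apply: (@choice _ _ (fun w v => tp (tcat v (tcat (tcat n (tcat b c)) w)) =
    ultra_type U (tcat (tcat n (tcat b c)) w))) => w.
  apply: (ultra_type_realized hK hsat) => //.
  apply: (small_sum hK); last by exact (small_prod hK (small_nat hK) sJ).
  by apply: (small_sum hK) => //; exact: (small_sum hK).
pose fix pre k : nat * J -> M := if k is k'.+1 then
  fun t => if t.1 == k' then next (pre k') t.2 else pre k' t else fun=> n m0.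
pose s k := next (pre k).
have preE k : pre k = trunc k s.
  elim: k => [|k IHk]; first by apply/funext => -[].
  apply/funext => -[j x] /=; case: eqP => [->|jk].
    by rewrite /trunc /= ltnSn.
  by rewrite IHk /trunc /= ltnS [in RHS]leq_eqVlt; case: eqP.
suff half (x : J -> M) (y : J -> J + J) : tp (tcat x n) = ultra_type U n ->
    x = tcat b c \o y -> morley U (scons x s).
  by exists s; split; [apply: (half b inl)|apply: (half c inr)].
move=> xU xy; case=> [|k].
  have -> : trunc 0 (scons x s) = fun=> n m0 by apply/funext => -[].
  have := ultra_type_rename
    (fun t : N + nat * J => match t with inl z => z | inr _ => m0 end) xU.
  suff -> : n \o (fun t : N + nat * J => match t with inl z => z | inr _ => m0 end)
    = tcat n (fun=> n m0) by [].
  by apply/funext => -[].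
pose r (t : N + nat * J) : (N + (J + J)) + nat * J := match t with
  | inl z => inl (inl z)
  | inr (0, j) => inl (inr (y j))
  | inr (i.+1, j) => inr (i, j) end.
have := ultra_type_rename r (nextP (pre k)).
suff -> : tcat (tcat n (tcat b c)) (pre k) \o r = tcat n (trunc k.+1 (scons x s)).
  by [].
by apply/funext => -[//|[[|i] j]] /=; rewrite /trunc /= ?preE// xy.
Qed.

(** By compactness only finitely many index patterns matter. These are met by [s m], [s (m-1)], ...
    for large [m], after an automorphism over [N] taking the pair [s (m-1)], [s m] to [s 0],
    [s 1]. *)
Lemma indiscernible_rev s : indiscernible_over s ->
  exists t, [/\ indiscernible_over t, t 0 = s 1 & t 1 = s 0].
Proof.
move=> ind; pose V := (nat * J)%type; pose P := (N + (J + J))%type.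
(* The condition [X d] says that the new sequence, read along a decreasing map, has the type of an
   initial segment of [s]. *)
pose D := {ki : nat * (nat -> nat) | decr_below ki.1 ki.2}.
pose r (d : D) (t : N + nat * J) : V + P := match t with
  | inl x => inr (inl x)
  | inr (j, x) => if (j < (sval d).1)%N then inl ((sval d).2 j, x)
                  else inr (inl m0) end.
pose X (d : D) := [set v : V + P -> M |
  [/\ tp (v \o r d) = tp (tcat n (trunc (sval d).1 s)),
      eq_tde M J (v \o (fun j => inl (0, j))) (v \o (inr \o (inr \o inl))) &
      eq_tde M J (v \o (fun j => inl (1, j))) (v \o (inr \o (inr \o inr)))]].
have tX d : tdef (X d).
  have := tdef_and (tdef_tp (r d) (tcat n (trunc (sval d).1 s)))
    (tdef_and (tdef_tde (eq_tde M J) (fun j => inl (0, j) : V + P)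
       (inr \o (inr \o inl)))
     (tdef_tde (eq_tde M J) (fun j => inl (1, j) : V + P)
       (inr \o (inr \o inr)))).
  by apply: tdef_eq => v; split=> [[? []]|[]].
pose cur (v : V -> M) k j := v (k, j).
have cur_r v d : tcat v (tcat n (tcat (s 1) (s 0))) \o r d =
    tcat n (trunc (sval d).1 (cur v \o (sval d).2)).
  by apply/funext => -[//|[j x]] /=; rewrite /trunc /=; case: ifP.
have [|||v vX] := tdef_compact hK hsat (u := tcat n (tcat (s 1) (s 0))) _ _ tX.
- by exact (small_prod hK (small_nat hK) sJ).
- by apply: (small_sum hK) => //; exact: (small_sum hK).
- move=> S Sfin; pose f (d : D) := \max_(j < (sval d).1) (sval d).2 j.
  have [m' m'P] := finite_nat_bounded (finite_image f Sfin).
  (* [m] bounds all indices in the finitely many patterns, and is positive so that the position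
     [m - 1] exists. *)
  pose m := m'.+1.
  have mP d j : S d -> (j < (sval d).1)%N -> ((sval d).2 j <= m)%N.
    move=> Sd jd; apply: leq_trans (leqW (m'P _ (imageP f Sd))).
    exact: (leq_bigmax (Ordinal jd)).
  have ind2 : tp (tcat n (trunc 2 (s \o (fun j => j + m')%N))) = tp (tcat n (trunc 2 s)).
    by apply: ind => j l jl _; rewrite ltn_add2r.
  have [g gs] := hhom
    (small_sum hK sN (small_prod hK (small_nat hK) sJ)) ind2.
  have gn x : g (n x) = n x by exact: (congr1 (fun h => h (inl x)) gs).
  have g0 j : g (s m' j) = s 0 j by exact: (congr1 (fun h => h (inr (0, j))) gs).
  have g1 j : g (s m j) = s 1 j by exact: (congr1 (fun h => h (inr (1, j))) gs).
  exists (fun t => g (s (m - t.1)%N t.2)) => d Sd; split.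
  + rewrite cur_r.
    have -> : tcat n (trunc (sval d).1
          (cur (fun t => g (s (m - t.1)%N t.2)) \o (sval d).2))
        = g \o tcat n (trunc (sval d).1 (s \o (fun j => m - (sval d).2 j)%N)).
      rewrite tcat_comp; congr tcat; first by apply/funext => x /=; rewrite gn.
      by apply/funext => -[j x]; rewrite /trunc /=; case: ifP => //= _; rewrite gn.
    rewrite tp_aut; apply: ind => j l jl ld.
    have dl := svalP d j l jl ld; apply: ltn_sub2l => //.
    by apply: leq_trans dl _; apply: mP => //; exact: ltn_trans ld.
  + by apply/eq_tdeP/funext => j /=; rewrite subn0 g1.
  + by apply/eq_tdeP/funext => j /=; rewrite subn1 g0.
(* The conditions concern decreasing maps, so an increasing map is read backwards; the map [q] below
   reverses the first [k] terms again. *)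
have rev_decr k i : incr_below k i -> decr_below k (fun j => i (k.-1 - j)%N).
  move=> ik j l jl lk; have k0 : (0 < k)%N by apply: leq_ltn_trans lk.
  apply: ik; last by apply: leq_ltn_trans (leq_subr _ _) _; rewrite ltn_predL.
  by apply: ltn_sub2l => //; apply: leq_trans jl _; rewrite -ltnS prednK.
have d0 : decr_below 0 id by move=> j l _.
exists (cur v); split.
- move=> k i ik.
  have vk i' : incr_below k i' ->
      tp (tcat n (trunc k (cur v \o (fun j => i' (k.-1 - j)%N)))) =
      tp (tcat n (trunc k s)).
    move=> i'k; pose d : D := exist (fun ki : nat * (nat -> nat) =>
      decr_below ki.1 ki.2) (k, _) (rev_decr k i' i'k).
    by have [+ _ _] := vX d; rewrite cur_r.
  have idk : incr_below k id by [].
  pose q (t : N + nat * J) : N + nat * J := match t with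
    | inl x => inl x | inr (j, x) => inr (if (j < k)%N then (k.-1 - j)%N else j, x) end.
  have eq_q i' : tcat n (trunc k (cur v \o i')) =
      tcat n (trunc k (cur v \o (fun j => i' (k.-1 - j)%N))) \o q.
    apply/funext => -[//|[j x]] /=; rewrite /trunc /=.
    case: ifP => jk; last by rewrite jk.
    have k0 : (0 < k)%N by apply: leq_ltn_trans jk.
    by rewrite (leq_ltn_trans (leq_subr _ _)) ?ltn_predL// subKn// -ltnS prednK.
  by rewrite [in LHS]eq_q [in RHS](eq_q id); apply: tp_comp; rewrite vk// (vk id).
- by have [_ /eq_tdeP + _] := vX (exist _ (0, id) d0).
- by have [_ _ /eq_tdeP] := vX (exist _ (0, id) d0).
Qed.

End Morley.

(** * Lascar distance *)

Section Diameter.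
Variables (K : Type) (L : language) (M : structure L).
Variables (I : Type) (E : tdequiv M I) (a : I -> M).
Hypothesis hK : small K (formula L nat).
Hypothesis hsat : saturated K M.
Hypothesis hhom : strongly_homogeneous K M.
Variables (J : Type) (F : tdequiv M J).
Hypothesis sJ : small K J.

Lemma indiscernible_over_model (N : set M) (m0 : N) s : small_model K E a N ->
  indiscernible_over m0 s -> indiscernible E a F s.
Proof.
move=> [elN sN dN] ind n i ik; pose i' k := i (inord k).
have i'k : incr_below n.+1 i'.
  by move=> j l jl ln; apply: ik; rewrite !inordK//; exact: ltn_trans ln.
have [f fs] := hhom (small_sum hK sN (small_prod hK (small_nat hK) sJ))
  (esym (ind _ _ i'k)).
have fN : fixes f N.
  by move=> x /mem_set Nx; exact: (congr1 (fun h => h (inl (exist _ x Nx))) fs).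
exists f; first exact: dN.
move=> k; rewrite (_ : f \o s k = s (i k)); first exact: tde_refl.
apply/funext => j; have := congr1 (fun h => h (inr (nat_of_ord k, j))) fs.
by rewrite /= /trunc /= ltn_ord /i' inord_val.
Qed.

Lemma lascar_dist_congr n b c d : lascar_dist_le E a F n b c -> F c d ->
  lascar_dist_le E a F n b d.
Proof.
by move=> [p [p0 pn ps]] cd; exists p; split=> //; exact: tde_trans cd.
Qed.

Lemma lascar_dist_trans n m b c d : lascar_dist_le E a F n b c ->
  lascar_dist_le E a F m c d -> lascar_dist_le E a F (n + m) b d.
Proof.
move=> [p [p0 pn ps]] [q [q0 qm qs]].
exists (fun i => if (i < n)%N then p i else q (i - n)%N); split.
- case: ltnP => [//|]; rewrite leqn0 => /eqP n0; rewrite n0 subn0.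
  by apply: tde_trans q0; rewrite n0 in pn; exact: tde_trans pn.
- by rewrite ltnNge leq_addr /= addKn.
- move=> i inm; case: (ltngtP i.+1 n) => [iltn|ni|ni].
  + by apply: ps; exact: ltnW.
  + rewrite subSn//; apply: qs.
    by rewrite ltn_subLR.
  (* At the seam the last step of [p] is made to end at [q 0], which lies in the class of [p n]. *)
  + rewrite -ni subnn; have [|s [ind s0 s1]] := ps i; first by rewrite -ni.
    exists s; split=> //; apply: tde_trans q0; apply: tde_trans s1 _.
    by rewrite ni.
Qed.

(** [b] and its image have the same type over [N], so both start Morley sequences with a common tail
    [s]. The first one joins [b] to [s 0], and the reversal of the second joins [s 0] to the
    image. *)
Lemma strong_gen_lascar_dist h (b : J -> M) : strong_gen K E a h ->
  lascar_dist_le E a F 2 b (h \o b).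
Proof.
move=> [N mN hN]; have [elN sN dN] := mN; pose n : N -> M := set_val.
have [U [UU UN bU]] := coheir b elN.
have [N0 _] := elN; have [x0 Nx0] := N0.
pose m0 : N := exist (fun x => x \in N) x0 (mem_set Nx0).
have cU : tp (tcat (h \o b) n) = ultra_type U n.
  rewrite -bU -(tp_aut h (tcat b n)) tcat_comp; congr (tp (tcat _ _)).
  by apply/funext => x /=; rewrite hN//; exact: set_valP.
have [s [sb sc]] := morley_exists hK hsat m0 sJ sN UU bU cU.
have indb := morley_indiscernible UU UN sb.
have [t [indt t0 t1]] :=
  indiscernible_rev hK hsat hhom sJ sN (morley_indiscernible UU UN sc).
exists (fun i => if i is i'.+1 then if i' is 0 then s 0 else h \o b else b).
split; [exact: tde_refl|exact: tde_refl|].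
case=> [_|[_|//]].
  exists (scons b s); split; [|exact: tde_refl|exact: tde_refl].
  exact: indiscernible_over_model indb.
exists t; split; first exact: indiscernible_over_model indt.
- by rewrite t0; exact: tde_refl.
- by rewrite t1; exact: tde_refl.
Qed.

Lemma strong_lascar_dist n b c : strong_dist K E a F n b c ->
  lascar_dist_le E a F n.*2 b c.
Proof.
elim: n c => [|n IHn] c /=.
  by move=> bc; exists (fun=> b); split=> //; exact: tde_refl.
move=> [x [h [/IHn bx gh hxc]]]; rewrite doubleS -addn2.
apply: lascar_dist_congr hxc; apply: lascar_dist_trans bx _.
exact: strong_gen_lascar_dist.
Qed.

End Diameter.

(** * Diameters of type-definable Lascar classes *)

Section MaximalFilter.
Variables (G : groupType) (X : Type) (act : G -> X -> X) (H : set G) (C : set X).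
Hypotheses (act1 : forall x, act 1%g x = x).
Hypotheses (actM : forall g h x, act (g * h)%g x = act g (act h x)).
Hypotheses (H1 : H 1%g) (HM : forall g h, H g -> H h -> H (g * h)%g).
Hypotheses (C0 : C !=set0) (CH : forall g x, H g -> C x -> C (act g x)).

Definition invariant_filter (Pi : set_system X) := [/\ ProperFilter Pi,
  forall g T, H g -> Pi T -> Pi (act g @^-1` T) & Pi C].

(* Dually, the closed set of ultrafilters containing [Pi] is a minimal subflow
   of the closure of [C]; the conclusion says that finitely many translates of
   a nonempty open subset cover a minimal subflow. *)
Lemma maximal_invariant_filter : exists2 Pi, invariant_filter Pi &
  forall S, ~ Pi (~` S) -> exists P (gs : seq G), [/\ Pi P,
    forall g, g \in gs -> H g &
    forall x, P x -> exists2 g, g \in gs & S (act g x)].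
Proof.
pose good Pi := invariant_filter Pi \/ Pi = set0.
have [|Pi [goodPi Pimax]] := @Zorn_bigcup _ good.
  move=> A Agood Atot.
  have Ain Q T : A Q -> Q T -> invariant_filter Q.
    by move=> /Agood[//|->].
  have two S T : (\bigcup_(Q in A) Q) S -> (\bigcup_(Q in A) Q) T ->
      exists2 Q, A Q & Q S /\ Q T.
    move=> [Q AQ QS] [R AR RT]; have [QR|RQ] := Atot _ _ AQ AR.
      by exists R => //; split=> //; exact: QR.
    by exists Q => //; split=> //; exact: RQ.
  have [[T [Q AQ QT]]|nT] := pselect (exists T, (\bigcup_(Q in A) Q) T); last first.
    by right; apply/seteqP; split=> // T UT; case: nT; exists T.
  have [QF QH QC] := Ain _ _ AQ QT; left; split; last by exists Q.
    split; first by move=> [R AR R0]; have [RF _ _] := Ain _ _ AR R0;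
      exact: (filter_not_empty R).
    split.
    - by exists Q => //; exact: filterT.
    - move=> S S' US US'; have [R AR [RS RS']] := two _ _ US US'.
      have [RF _ _] := Ain _ _ AR RS.
      by exists R => //; exact: filterI.
    - move=> S S' SS' [R AR RS]; have [RF _ _] := Ain _ _ AR RS.
      by exists R => //; exact: filterS RS.
  move=> g S Hg [R AR RS]; have [_ RH _] := Ain _ _ AR RS.
  by exists R => //; exact: RH.
have {goodPi} invPi : invariant_filter Pi.
  case: goodPi => // Pi0; exfalso; apply: (Pimax [set T | C `<=` T]).
    split; first by rewrite Pi0.
    by move=> /(_ C (fun x => id)); rewrite Pi0.
  left; split=> //; last first.
    by move=> g T Hg CT x Cx; apply/CT/CH.
  split; first by have [x Cx] := C0 => /(_ x Cx).
  split=> // [S T CS CT x Cx|S T ST CS x /CS/ST//].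
  by split; [exact: CS|exact: CT].
exists Pi => // S nS; have [PF PH PC] := invPi.
(* [Pi'] is generated by [Pi] and the complements of all translates of [S]. It contains the
   complement of [S], so by maximality of [Pi] it is not proper, which is the desired covering. *)
pose cov T P (gs : seq G) := [/\ Pi P, forall g, g \in gs -> H g &
  forall x, P x -> (forall g, g \in gs -> ~ S (act g x)) -> T x].
pose Pi' T := exists P gs, cov T P gs.
have PiPi' : Pi `<=` Pi' by move=> T PiT; exists T, [::].
have Pi'S : Pi' (~` S).
  exists setT, [:: 1%g]; split; first exact: filterT.
    by move=> g; rewrite inE => /eqP ->.
  by move=> x _ /(_ 1%g); rewrite inE eqxx act1; exact.
have [[P [gs [PiP Hgs cov0]]]|n0] := pselect (Pi' set0).
  exists P, gs; split=> // x Px; apply: contrapT => nx.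
  by apply: (cov0 x Px) => g ggs Sgx; apply: nx; exists g.
exfalso; apply: (Pimax Pi'); first by split=> // /(_ _ Pi'S).
left; split; last exact: PiPi'.
  split=> //; split; first by apply: PiPi'; exact: filterT.
    move=> T T' [P [gs [PiP Hgs PT]]] [P' [gs' [PiP' Hgs' PT']]].
    exists (P `&` P'), (gs ++ gs'); split; first exact: filterI.
      by move=> g; rewrite mem_cat => /orP[/Hgs|/Hgs'].
    move=> x [Px P'x] nS'; split.
      by apply: PT => // g ggs; apply: nS'; rewrite mem_cat ggs.
    by apply: PT' => // g ggs; apply: nS'; rewrite mem_cat ggs orbT.
  move=> T T' TT' [P [gs [PiP Hgs PT]]]; exists P, gs; split=> // x Px nx.
  exact/TT'/PT.
move=> g T Hg [P [gs [PiP Hgs PT]]].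
exists (act g @^-1` P), [seq (h * g)%g | h <- gs]; split; first exact: PH.
  by move=> _ /mapP[h hgs ->]; apply: HM => //; exact: Hgs.
move=> x Px nx; apply: PT => // h hgs; rewrite -actM; apply: nx.
exact: map_f.
Qed.

End MaximalFilter.

Section Newelski.
Variables (K : Type) (L : language) (M : structure L).
Variables (I : Type) (E : tdequiv M I) (a : I -> M).
Hypothesis hK : small K (formula L nat).
Hypothesis hsat : saturated K M.
Hypothesis hhom : strongly_homogeneous K M.
Hypothesis sI : small K I.
Variables (J : Type) (F : tdequiv M J) (b : J -> M).
Hypothesis sJ : small K J.
Let dist := strong_dist K E a F.

(** Makes it possible to compare, at a single point [x], conditions that hold along one filter over
    different parameters. *)
Lemma filter_realized2 P (U : set_system (J -> M)) (u u' : P -> M)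
    (p p' : set (formula L (J + P))) : ProperFilter U -> small K P ->
  (forall phi, p phi -> U [set x | sat (tcat x u) phi]) ->
  (forall phi, p' phi -> U [set x | sat (tcat x u') phi]) ->
  exists x, realizes (tcat x u) p /\ realizes (tcat x u') p'.
Proof.
move=> UF sP Up Up'.
pose r (t : J + P) : J + (P + P) := match t with
  | inl j => inl j | inr i => inr (inl i) end.
pose r' (t : J + P) : J + (P + P) := match t with
  | inl j => inl j | inr i => inr (inr i) end.
have e (x : J -> M) : tcat x (tcat u u') \o r = tcat x u.
  by apply/funext => -[].
have e' (x : J -> M) : tcat x (tcat u u') \o r' = tcat x u'.
  by apply/funext => -[].
have [||x xq] := filter_realized hK hsat (U := U) (u := tcat u u')
    (q := (frename r @` p) `|` (frename r' @` p')) _ sJ.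
- exact: (small_sum hK).
- move=> _ [[phi pphi <-]|[phi pphi <-]].
    by apply: filterS (Up _ pphi) => x /= h; apply/sat_frename; rewrite e.
  by apply: filterS (Up' _ pphi) => x /= h; apply/sat_frename; rewrite e'.
exists x; move/realizesU: xq => [xp xp']; split=> phi pphi.
  by rewrite -e; apply/sat_frename/xp; exists phi.
by rewrite -e'; apply/sat_frename/xp'; exists phi.
Qed.

Lemma strong_dist_type n : exists p : set (formula L (J + (I + J))), forall b x,
  realizes (tcat x (tcat a b)) p <-> dist n b x.
Proof.
have [X tX XP] := tdef_strong_dist E a hK hsat hhom sI F sJ n.
pose r (t : (J + J) + I) : J + (I + J) := match t with
  | inl (inl j) => inr (inr j) | inl (inr j) => inl j | inr i => inr (inl i) end.
have [p pX] := tdef_pre r tX; exists p => b' x; rewrite -pX /=.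
suff -> : tcat x (tcat a b') \o r = tcat (tcat b' x) a by exact: XP.
by apply/funext => -[[]|].
Qed.

(** The type [Psi] provides the compactness behind the Baire argument on the orbit [C]; the bound is
    then spread by the group, first to every ultrafilter above [Pi] and from there to [C]. *)
Lemma newelski (Psi : set (formula L (J + (I + J)))) :
  (forall c, realizes (tcat c (tcat a b)) Psi <-> lascar_equiv K E a F c b) ->
  exists n, forall c, lascar_equiv K E a F c b -> dist n b c.
Proof.
move=> PsiP; pose C := [set c | lascar_equiv K E a F c b].
have [p pP] := choice strong_dist_type.
pose act (g : aut M) (x : J -> M) := g \o x.
have actM g h x : act (g * h)%g x = act g (act h x) by rewrite /act autM.
have Cb : C b by exists 1%g; [exact: Autfe_1|rewrite aut1; exact: tde_refl].
have CH g x : Autfe K E a g -> C x -> C (act g x).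
  move=> Hg [f Hf fx]; exists (f * g^-1)%g; first by apply: Autfe_M => //; exact: Autfe_V.
  by rewrite autM /act -compA autK.
have [|||||Pi [PF PH PC] Picov] :=
  @maximal_invariant_filter (aut M) _ act (Autfe K E a) C _ actM.
- by [].
- exact: Autfe_1.
- by move=> g h; exact: Autfe_M.
- by exists b.
- exact: CH.
pose bad phi := [set x : J -> M | ~ sat (tcat x (tcat a b)) phi].
(* Baire category: some [S] that [Pi] does not exclude lies within distance n of [b], modulo [Pi]
   and formula by formula. Otherwise one successively imposes the failure of a formula of each
   [p n], and compactness inside [Psi] gives a Lascar conjugate of [b] at no finite distance from
   it. *)
have [n [S [nS Sp]]] : exists n S, ~ Pi (~` S) /\
    forall phi, p n phi -> Pi (~` (S `&` bad phi)).
  apply: contrapT => no.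
  have /choice[w wP] (nS : nat * set (J -> M)) : exists phi, ~ Pi (~` nS.2) ->
      p nS.1 phi /\ ~ Pi (~` (nS.2 `&` bad phi)).
    have [PS|PS] := pselect (Pi (~` nS.2)); first by exists Bot.
    apply: contrapT => nphi; apply: no; exists nS.1, nS.2; split=> // phi pphi.
    by apply: contrapT => nPi; apply: nphi; exists phi.
  pose fix Sn n := if n is n'.+1 then Sn n' `&` bad (w (n', Sn n')) else setT.
  have SnP n : ~ Pi (~` Sn n).
    elim: n => [|n IHn]; first by rewrite /= setCT; exact: filter_not_empty.
    by have [] := wP (n, Sn n) IHn.
  pose X n := [set v : J + (I + J) -> M |
    realizes v Psi /\ sat v (Neg (w (n, Sn n)))].
  have tX n : tdef (X n) by apply: tdef_and; [exact: tdef_realizes|exact: tdef_sat].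
  have [|n|x xX] := tdef_compact_nat hK hsat (u := tcat a b) sJ _ tX.
  - exact: (small_sum hK).
  - have [x [Cx Sx]] : exists x, C x /\ Sn n.+1 x.
      apply: contrapT => nx; apply: (SnP n.+1); apply: filterS PC => x Cx Sx.
      by apply: nx; exists x.
    exists x => m mn; split; first exact/PsiP.
    elim: n mn Sx => [|n IHn] mn /= [Sx bx].
      by move: mn; rewrite leqn0 => /eqP ->.
    by move: mn; rewrite leq_eqVlt => /orP[/eqP -> //|mn]; exact: IHn.
  have /PsiP Cx := (xX 0).1.
  have /lascar_equivP[n bx] := lascar_equiv_sym Cx.
  have [_] := xX n; apply; have [pw _] := wP (n, Sn n) (SnP n).
  exact: (iffRL (pP n b x) bx).
have [P [gs [PiP Hgs cov]]] := Picov S nS.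
(* Only finitely many translates occur, and each moves [b] by a finite distance. *)
have [k kP] : exists k, forall g, g \in gs -> dist k b ((g^-1)%g \o b).
  elim: gs Hgs {cov} => [|g gs IHgs] Hgs; first by exists 0.
  have [k kP] : exists k, forall g, g \in gs -> dist k b ((g^-1)%g \o b).
    by apply: IHgs => h hgs; apply: Hgs; rewrite inE hgs orbT.
  have /lascar_equivP[l lP] : lascar_equiv K E a F b ((g^-1)%g \o b).
    exists (g^-1)%g; last exact: tde_refl.
    by apply: Autfe_V => //; apply: Hgs; rewrite inE eqxx.
  exists (maxn k l) => h; rewrite inE => /orP[/eqP ->|/kP bh].
    by apply: (strong_dist_mono hK sI) lP; exact: leq_maxr.
  by apply: (strong_dist_mono hK sI) bh; exact: leq_maxl.
(* The points of the minimal subflow are within k + n of [b]: some translate of [S] by [g] in [gs]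
   belongs to [U], which puts [x] within n of the preimage of [b] under [g], itself within k of
   [b]. *)
have claim (U : set_system (J -> M)) : ProperFilter U ->
    (forall T, U T \/ U (~` T)) -> Pi `<=` U ->
    forall phi, p (k + n) phi -> U [set x | sat (tcat x (tcat a b)) phi].
  move=> UF Uult PiU phi pphi.
  have [g ggs US] : exists2 g, g \in gs & U (act g @^-1` S).
    apply: contrapT => ng.
    suff UN : U [set x | forall g, g \in gs -> ~ S (act g x)].
      have [x [nx /cov[g ggs Sgx]]] := filter_ex (filterI UN (PiU _ PiP)).
      exact: nx Sgx.
    have : forall g, g \in gs -> ~ U (act g @^-1` S).
      by move=> g ggs US; apply: ng; exists g.
    elim: (gs) => [|g gs' IHgs] nU; first by apply: filterS filterT.
    have Ug : U (~` (act g @^-1` S)).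
      by have [/nU|//] := Uult (act g @^-1` S); rewrite inE eqxx => /(_ isT).
    apply: filterS (filterI Ug (IHgs _)) => [x [ngx nx] h|h hgs].
      by rewrite inE => /orP[/eqP -> //|]; exact: nx.
    by apply: nU; rewrite inE hgs orbT.
  have Hg := Hgs g ggs.
  (* A condition on the image of [x] over [a], [b] is a condition on [x] over the preimages of [a],
     [b]. *)
  have e x : tcat (g \o x) (tcat a b) =
      g \o tcat x (tcat ((g^-1)%g \o a) ((g^-1)%g \o b)).
    by rewrite !tcat_comp !autVK.
  have Up psi : p n psi ->
      U [set x | sat (tcat x (tcat ((g^-1)%g \o a) ((g^-1)%g \o b))) psi].
    move=> ppsi; have Pib := PH g _ Hg (Sp psi ppsi).
    apply: filterS (filterI US (PiU _ Pib)) => x [Sgx nb] /=.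
    apply: contrapT => nx; apply: nb; split=> //; rewrite /bad /= /act e.
    by rewrite sat_aut.
  have [//|Un] := Uult [set x | sat (tcat x (tcat a b)) phi].
  have Un' psi : [set Neg phi] psi -> U [set x | sat (tcat x (tcat a b)) psi].
    by move=> ->; exact: Un.
  have [x [xp xn]] := filter_realized2 UF (small_sum hK sI sJ) Up Un'.
  have bgx : dist n b (g \o x).
    by apply/pP; rewrite e; apply/realizes_aut.
  have /pP/(_ phi pphi) : dist (k + n) b x.
    apply: strong_dist_trans (kP g ggs) _; rewrite -[x](autK g).
    by apply: strong_dist_aut => //; apply/Aute_V/(Autfe_Aute Hg).
  by move=> h; case: (xn (Neg phi) erefl h).
(* An ultrafilter [U] above [Pi] and its translate by [f] both satisfy the claim, so some [x] is
   within k + n of [b] and of the preimage of [b] under [f], which lies in the class of [c]. *)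
exists ((k + n) + (k + n)) => c [f Hf fcb].
have [U [UU PiU]] := ultraFilterLemma PF.
have Uult T : U T \/ U (~` T) by exact: in_ultra_setVsetC.
have UF := @ultra_proper _ U UU.
have Ub := claim U UF Uult PiU.
have ef x : tcat (f \o x) (tcat a b) =
    f \o tcat x (tcat ((f^-1)%g \o a) ((f^-1)%g \o b)).
  by rewrite !tcat_comp !autVK.
have Uf phi : p (k + n) phi ->
    U [set x | sat (tcat x (tcat ((f^-1)%g \o a) ((f^-1)%g \o b))) phi].
  move=> pphi; pose V : set_system (J -> M) := [set T | U (act f @^-1` T)].
  have VF : ProperFilter V.
    split; first by rewrite /V /= preimage_set0; exact: filter_not_empty.
    split.
    - by rewrite /V /= preimage_setT; exact: filterT.
    - by move=> S' T' VS VT; rewrite /V /= preimage_setI; exact: filterI.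
    - by move=> S' T' ST; apply: filterS => x; exact: ST.
  have VT : V [set x | sat (tcat x (tcat a b)) phi].
    apply: claim => //; first by move=> T; exact: Uult.
    by move=> T PiT; apply: PiU; exact: PH.
  by apply: filterS (VT : U _) => x /=; rewrite /act ef sat_aut.
have [x [xb xf]] := filter_realized2 UF (small_sum hK sI sJ) Ub Uf.
have /pP bx := xb.
have bfx : dist (k + n) b (f \o x).
  by apply/pP; rewrite ef; apply/realizes_aut.
have fbx : dist (k + n) ((f^-1)%g \o b) x.
  rewrite -[x](autK f); apply: strong_dist_aut => //.
  by apply/Aute_V/(Autfe_Aute Hf).
apply: strong_dist_congr (strong_dist_trans bx (strong_dist_sym fbx)).
  exact: tde_refl.
by apply/tde_autl; rewrite invgK; exact: tde_sym.
Qed.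

End Newelski.

(** * The topology of the Lascar group *)

Section StoneSpace.
Variables (L : language) (M : structure L) (V : Type) (A : set M).

Lemma stone_open_formulas (P : set (formula L (V + A))) :
  open [set p : stone V A | exists2 phi, P phi & set_val p phi].
Proof.
have -> : [set p : stone V A | exists2 phi, P phi & set_val p phi] =
    \bigcup_(phi in P) [set p : stone V A | set_val p phi].
  by apply/seteqP; split=> p [phi]; exists phi.
apply: bigcup_open => phi Pphi.
exists [set [set p : stone V A | set_val p phi]]; last by rewrite bigcup_set1.
move=> _ ->; exact: finI_from1.
Qed.

Lemma stone_open_nbhs (O : set (stone V A)) p v : open O -> O p ->
  set_val p = tp_over v A -> exists phi, sat (tcat v (set_val : A -> M)) phi /\
    forall (q : stone V A) w, set_val q = tp_over w A ->
      sat (tcat w (set_val : A -> M)) phi -> O q.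
Proof.
move=> [D DfinI <-] [S DS Sp] pv; have [s _ sS] := DfinI _ DS.
have [phi phiP] := finite_conj (@finite_fset _ s).
exists phi; split.
  by apply/phiP => psi psis; rewrite -sS in Sp; have := Sp psi psis; rewrite /= pv.
move=> q w qw /phiP wphi; suff Sq : S q by exists S.
by rewrite -sS => psi psis /=; rewrite qw; exact: wphi.
Qed.

End StoneSpace.

Section GCompact.
Variables (K : Type) (L : language) (M : structure L).
Variables (I : Type) (E : tdequiv M I) (a : I -> M).
Hypothesis hK : small K (formula L nat).
Hypothesis hsat : saturated K M.
Hypothesis hhom : strongly_homogeneous K M.

Lemma gal_pi_eq1 (f : Aute E a) :
  gal_pi K f = gal_pi K (exist _ 1%g (Aute1 E a) : Aute E a) <->
  Autfe K E a (set_val f).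
Proof.
have [S1 _] := Autfe_subgroup K E a.
rewrite /gal_pi; split.
  move/eqmodP; rewrite /= /galeq /= mulg1 => /set_mem h.
  by rewrite -[set_val f]invgK; exact: Autfe_V.
move=> h; apply/eqmodP; rewrite /= /galeq /= mulg1; apply/mem_set.
exact: Autfe_V.
Qed.

Lemma tp_over_complete (V : Type) (B : set M) (v : V -> M) :
  complete_type V B (tp_over v B).
Proof.
split; first by move=> q _ qv; exists v => phi /qv.
by move=> phi; exact: lem.
Qed.

(** This is why the map to the Lascar group is well defined: an automorphism [h] over [B] makes
    [h * f] agree with [g] on [A], so [f] and [g] differ by elementary strong factors, one fixing
    [B] and one fixing [A]. *)
Lemma Autfe_tp (A B : set M) (f g : aut M) : small_model K E a A ->
  small_model K E a B ->
  tp_over (f \o (set_val : A -> M)) B = tp_over (g \o (set_val : A -> M)) B ->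
  Autfe K E a f -> Autfe K E a g.
Proof.
move=> mA mB fg Hf; have [_ sA _] := mA; have [_ sB _] := mB.
have [h hfg] := hhom (small_sum hK sA sB) fg.
rewrite tcat_comp in hfg.
have -> : g = (h * f * (g^-1 * (h * f))^-1)%g by rewrite invgM invgK mulVKg.
apply: Autfe_M; first apply: Autfe_M => //.
  apply: Autfe_gen; exists B => // x /mem_set Bx.
  exact: (congr1 (fun k => k (inr (exist _ x Bx))) hfg).
apply: Autfe_V; apply: Autfe_gen; exists A => // x /mem_set Ax; rewrite !autM.
rewrite /= (_ : h (f x) = g x); first exact: aut_funK.
exact: (congr1 (fun k => k (inl (exist _ x Ax))) hfg).
Qed.

Lemma nu_eq1 (A B : set M) (p : SMN E a A B) (f : Aute E a) :
  small_model K E a A -> small_model K E a B ->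
  set_val (set_val p) = tp_over (set_val f \o (set_val : A -> M)) B ->
  nu K p = gal_pi K (exist _ 1%g (Aute1 E a) : Aute E a) <->
  Autfe K E a (set_val f).
Proof.
move=> mA mB pf; rewrite /nu gal_pi_eq1; case: cid => g /= pg.
split; apply: Autfe_tp mA mB _; first exact: etrans (esym pg) pf.
exact: etrans (esym pf) pg.
Qed.

(** By [nu_eq1] the trivial class pulls back to the types tp(f(A)/B) with [f] in [Autfe], and a
    closed subset of the space of types is one cut out by a set of formulas. *)
Lemma G_compactP : G_compact K E a <->
  forall A B : set M, small_model K E a A -> small_model K E a B ->
    exists Psi : set (formula L (A + B)), forall f, Aute E a f ->
      realizes (tcat (f \o set_val) set_val) Psi <-> Autfe K E a f.
Proof.
pose one := gal_pi K (exist _ 1%g (Aute1 E a) : Aute E a).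
split=> [cl A B mA mB|H].
  have : open (~` [set one]) by rewrite openC.
  move=> /(_ A B mA mB)[O oO OE].
  pose e (f : aut M) : A + B -> M := tcat (f \o set_val) set_val.
  (* [Psi] negates every formula whose basic open set avoids the preimage of the trivial class. *)
  exists [set Neg chi | chi in [set chi | forall f, Aute E a f -> sat (e f) chi ->
    ~ Autfe K E a f]] => f fe; split; last first.
    by move=> Hf _ [chi chiP <-] /(chiP f fe).
  move=> fPsi; apply: contrapT => nf.
  have inS g : Aute E a g -> exists2 p : SMN E a A B,
      set_val (set_val p) = tp_over (g \o (set_val : A -> M)) B &
      (nu K p = one <-> Autfe K E a g).
    move=> ge; pose q : stone A B := exist (fun p => p \in complete_type A B) _
      (mem_set (tp_over_complete B (g \o (set_val : A -> M)))).
    pose g' : Aute E a := exist (fun f => f \in Aute E a) g (mem_set ge).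
    have qS : SMN E a A B q by exists g'.
    exists (exist (fun q => q \in SMN E a A B) q (mem_set qS)) => //.
    exact: (@nu_eq1 _ _ _ g').
  have [p pf pone] := inS f fe.
  have Op : O (set_val p).
    have : (@nu K L M I E a A B @^-1` (~` [set one])) p.
      by move=> /pone.
    by rewrite -OE.
  have [chi [fchi chiP]] := stone_open_nbhs oO Op pf.
  apply: (fPsi (Neg chi)) fchi; exists chi => // g ge gchi Hg.
  have [q qg qone] := inS g ge.
  have : (set_val @^-1` O) q by exact: chiP qg gchi.
  by rewrite OE; apply; apply/qone.
suff h : gal_open (~` [set one]) by rewrite /G_compact -openC; exact: h.
move=> A B mA mB; have [Psi PsiP] := H A B mA mB.
exists [set p : stone A B | exists2 phi, [set Neg psi | psi in Psi] phi & set_val p phi].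
  exact: stone_open_formulas.
apply/seteqP; split=> p /=.
  have [f pf] := set_valP p.
  move=> [_ [psi Psipsi <-]]; rewrite pf => npsi /(nu_eq1 mA mB pf).
  have fe := set_valP f.
  by move=> /(PsiP _ fe)/(_ _ Psipsi).
have [f pf] := set_valP p; have fe := set_valP f.
move=> np; apply: contrapT => nex; apply: np; apply/(nu_eq1 mA mB pf)/(PsiP _ fe).
move=> psi Psipsi; apply: contrapT => npsi; apply: nex; exists (Neg psi).
  by exists psi.
by rewrite pf.
Qed.

End GCompact.

(** * The equivalence *)

Section Equivalence.
Variables (K : Type) (L : language) (M : structure L).
Variables (I : Type) (E : tdequiv M I) (a : I -> M).
Hypothesis hK : small K (formula L nat).
Hypothesis hsat : saturated K M.
Hypothesis hhom : strongly_homogeneous K M.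
Hypothesis sI : small K I.

(** Quantify over all realizations [z] of tp(u/w): an automorphism taking [u] to [z] fixes [w],
    hence by [Xf] each [z] defines the same set as [u]. *)
Lemma tdef_params V P Q (X : set (V + P -> M)) (u : P -> M) (w : Q -> M) :
  small K V -> small K P -> small K Q -> tdef X ->
  (forall (f : aut M) v, f \o w = w -> X (tcat v u) -> X (tcat (f \o v) u)) ->
  exists Psi : set (formula L (V + Q)), forall v,
    realizes (tcat v w) Psi <-> X (tcat v u).
Proof.
move=> sV sP sQ tX Xf.
pose r1 (t : P + Q) : (V + Q) + P := match t with
  | inl z => inr z | inr q => inl (inr q) end.
pose r2 (t : V + P) : (V + Q) + P := match t with
  | inl x => inl (inl x) | inr z => inr z end.
have [Psi PsiP] := tdef_ex hK hsat (small_sum hK sV sQ) sP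
  (tdef_and (tdef_tp r1 (tcat u w)) (tdef_pre r2 tX)).
exists Psi => v; rewrite -PsiP /=.
have e1 z : tcat (tcat v w) z \o r1 = tcat z w by apply/funext => -[].
have e2 z : tcat (tcat v w) z \o r2 = tcat v z by apply/funext => -[].
split=> [[z]|Xvu]; last by exists u; rewrite e1 e2.
rewrite e1 e2 => -[zw Xvz].
have [f] := hhom (small_sum hK sP sQ) (esym zw); rewrite tcat_comp => fz.
have fu : f \o u = z by apply/funext => x; exact: (congr1 (fun h => h (inl x)) fz).
have fw : f \o w = w by apply/funext => x; exact: (congr1 (fun h => h (inr x)) fz).
rewrite -(autVK f v); apply: Xf => //.
by apply/(tdef_aut f _ tX); rewrite tcat_comp autVK fu.
Qed.

Lemma G_compact_type_definable : G_compact K E a ->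
  forall (J : Type) (F : tdequiv M J) (b : J -> M), small K J ->
    exists Psi : set (formula L (J + (I + J))), forall c : J -> M,
      realizes (tcat c (tcat a b)) Psi <-> lascar_equiv K E a F c b.
Proof.
move=> /(G_compactP E a hK hhom) Gc J F b sJ.
have [A [mA aA bA]] := small_model_exists hK E a sI (small_range b sJ).
have [elA sA dA] := mA; pose vA : A -> M := set_val.
pose rI i : A := exist (fun x => x \in A) (a i)
  (mem_set (aA _ (ex_intro2 _ _ i Logic.I erefl))).
pose rJ j : A := exist (fun x => x \in A) (b j)
  (mem_set (bA _ (ex_intro2 _ _ j Logic.I erefl))).
have aE : vA \o rI = a by apply/funext.
have bE : vA \o rJ = b by apply/funext.
have [Psi PsiP] := Gc A A mA mA.
pose k (t : A + A) : (J + A) + A := match t with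
  | inl y => inr y | inr z => inl (inr z) end.
(* The coordinates are (c, A, y) with [y] in the role of f(A): the second clause puts [f] in [Aute],
   [Psi] puts it in [Autfe], and the last says that it takes the class of [b] to that of [c]. *)
pose Y := [set v : (J + A) + A -> M |
  [/\ tp (v \o inr) = tp vA, E (v \o (inr \o rI)) (v \o (inl \o (inr \o rI))),
      realizes (v \o k) Psi & F (v \o (inr \o rJ)) (v \o (inl \o inl))]].
have tY : tdef Y.
  have := tdef_and (tdef_tp (inr : A -> (J + A) + A) vA)
    (tdef_and (tdef_tde E (inr \o rI : I -> (J + A) + A) (inl \o (inr \o rI)))
    (tdef_and (tdef_pre k (tdef_realizes M Psi))
       (tdef_tde F (inr \o rJ : J -> (J + A) + A) (inl \o inl)))).
  by apply: tdef_eq => v; split=> [[? [? []]]|[]].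
have XP c : (exists y, Y (tcat (tcat c vA) y)) <-> lascar_equiv K E a F c b.
  have ek y : tcat (tcat c vA) y \o k = tcat y vA by apply/funext => -[].
  split=> [[y [y1 y2 y3 y4]]|/lascar_equiv_sym[f Hf fbc]].
    apply: lascar_equiv_sym; have [f fy0] := hhom sA (esym y1).
    have fy : f \o vA = y := fy0.
    have fe : Aute E a f.
      suff h : E (f \o (vA \o rI)) (vA \o rI) by move: h; rewrite aE.
      by rewrite compA fy; exact: y2.
    exists f; last by rewrite -bE compA fy; exact: y4.
    by apply/(PsiP f fe); move: y3; rewrite ek -fy.
  have fe := Autfe_Aute Hf; exists (f \o vA); split.
  - exact: (tp_aut f vA).
  - have h : E (f \o (vA \o rI)) (vA \o rI) by rewrite aE; exact: fe.
    exact: h.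
  - by rewrite ek; apply/(PsiP f fe).
  - have h : F (f \o (vA \o rJ)) c by rewrite bE.
    exact: h.
(* The parameters drop from [A] to [a], [b], because conjugation by an automorphism fixing [a] and
   [b] preserves [Autfe]. *)
have [|Phi PhiP] := @tdef_params J A (I + J)%type _ vA (tcat a b) sJ sA
    (small_sum hK sI sJ) (tdef_ex hK hsat (small_sum hK sJ sA) sA tY).
  move=> f c fab /XP[g Hg gcb]; apply/XP.
  have fa : f \o a = a.
    by apply/funext => i; exact: (congr1 (fun h => h (inl i)) fab).
  have fb : f \o b = b.
    by apply/funext => j; exact: (congr1 (fun h => h (inr j)) fab).
  have fe : Aute E a f by rewrite /Aute /= fa; exact: tde_refl.
  exists (f * g * f^-1)%g; first exact: AutfeJ.
  rewrite !autM -fb (_ : _ \o _ = f \o (g \o c)); first exact/tde_aut.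
  by apply/funext => j /=; rewrite aut_funK.
by exists Phi => c; rewrite PhiP; exact: XP.
Qed.

Lemma type_definable_bounded :
  (forall (J : Type) (F : tdequiv M J) (b : J -> M), small K J ->
    exists Psi : set (formula L (J + (I + J))), forall c : J -> M,
      realizes (tcat c (tcat a b)) Psi <-> lascar_equiv K E a F c b) ->
  forall (J : Type) (F : tdequiv M J) (b : J -> M), small K J ->
    exists n : nat, forall c : J -> M,
      lascar_equiv K E a F c b -> lascar_dist_le E a F n b c.
Proof.
move=> H J F b sJ; have [Psi PsiP] := H J F b sJ.
have [n nP] := newelski hK hsat hhom sI sJ PsiP.
by exists n.*2 => c /nP; exact: strong_lascar_dist.
Qed.

Lemma bounded_uniform :
  (forall (J : Type) (F : tdequiv M J) (b : J -> M), small K J ->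
    exists n : nat, forall c : J -> M,
      lascar_equiv K E a F c b -> lascar_dist_le E a F n b c) ->
  exists n : nat, forall (J : Type) (F : tdequiv M J) (b c : J -> M),
    small K J -> lascar_equiv K E a F b c <-> lascar_dist_le E a F n b c.
Proof.
move=> H; have [A [r [mA ra]]] := model_over E a hK sI.
have [elA sA dA] := mA; pose vA : A -> M := set_val.
have [n nP] := H A (eq_tde M A) vA sA.
(* If [f] agrees on [A] with a product [g] of n factors, then [f] has n + 1 factors, the last one
   fixing [A]; each factor costs 2 in Lascar distance. *)
exists n.+1.*2 => J F b c sJ; split=> [[f Hf fbc]|bc]; last first.
  apply/lascar_equivP; exists n.+1.*2.
  exact: (lascar_dist_strong hK hsat hhom sI sJ bc).
apply: (strong_lascar_dist hK hsat hhom sJ); apply/strong_dist_pow; exists f => //.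
have /nP : lascar_equiv K E a (eq_tde M A) (f \o vA) vA.
  exists (f^-1)%g; first exact: Autfe_V.
  by rewrite autK; exact: tde_refl.
move=> /(lascar_dist_strong hK hsat hhom sI sA)/strong_dist_pow[g gn /eq_tdeP gf].
rewrite -addn1 (_ : f = (g * (g^-1 * f))%g); last by rewrite mulVKg.
apply: strong_powM gn _; apply: strong_pow_gen; exists A => // x /mem_set Ax.
rewrite autM.
have gfx := congr1 (fun h => h (exist _ x Ax)) gf.
by rewrite /= -[f x]gfx; exact: aut_funK.
Qed.

Lemma uniform_G_compact :
  (exists n : nat, forall (J : Type) (F : tdequiv M J) (b c : J -> M),
    small K J -> lascar_equiv K E a F b c <-> lascar_dist_le E a F n b c) ->
  G_compact K E a.
Proof.
move=> [n nP]; apply/(G_compactP E a hK hhom) => A B mA mB.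
have [elA sA dA] := mA; have [elB sB dB] := mB; pose vA : A -> M := set_val.
(* The uniform bound turns Lascar equivalence of enumerations of [A] into the type-definable
   relation [strong_dist] at [n]. *)
have lasP c : lascar_equiv K E a (eq_tde M A) vA c <->
    strong_dist K E a (eq_tde M A) n vA c.
  split=> [/nP h|h]; last by apply/lascar_equivP; exists n.
  exact: (lascar_dist_strong hK hsat hhom sI sA (h sA)).
have [p pP] := strong_dist_type E a hK hsat hhom sI (eq_tde M A) sA n.
(* The parameters pass to [B], because every automorphism fixing [B] is elementary strong and so
   preserves the Lascar class. *)
have [|Psi PsiP] := @tdef_params A (I + A)%type B _ (tcat a vA) set_val sA
    (small_sum hK sI sA) sB (tdef_realizes M p).
  move=> f c fB /pP/lasP[g Hg gc]; apply/pP/lasP.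
  exists (f * g)%g; last by rewrite autM -compA; apply/tde_aut.
  apply: Autfe_M => //; apply: Autfe_gen; exists B => // x /mem_set Bx.
  exact: (congr1 (fun h => h (exist _ x Bx)) fB).
exists Psi => f fe; rewrite PsiP; split=> [/pP/lasP[g Hg /eq_tdeP gf]|Hf].
  (* [f] agrees on [A] with some [g] in [Autfe], so they differ by a factor fixing the model [A]. *)
  rewrite (_ : f = (g * (g^-1 * f))%g); last by rewrite mulVKg.
  apply: Autfe_M => //; apply: Autfe_gen; exists A => // x /mem_set Ax.
  have gfx := congr1 (fun h => h (exist _ x Ax)) gf.
  by rewrite autM /= -[f x]gfx; exact: aut_funK.
by apply/pP/lasP; exists f => //; exact: tde_refl.
Qed.

End Equivalence.

Theorem corollary4p8 (L : language) (T : set (sentence L)) (K : Type)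
    (M : structure L) (I : Type) (E : tdequiv M I) (a : I -> M)
    (hT : complete_theory T) (hM : monster K T M) (hI : small K I) :
  [<->
    (* (1) *)
    G_compact K E a;
    (* (2) *)
    forall (J : Type) (F : tdequiv M J) (b : J -> M), small K J ->
      exists Psi : set (formula L (J + (I + J))),
        forall c : J -> M,
          realizes (tcat c (tcat a b)) Psi <-> lascar_equiv K E a F c b;
    (* (3) *)
    forall (J : Type) (F : tdequiv M J) (b : J -> M), small K J ->
      exists n : nat,
        forall c : J -> M,
          lascar_equiv K E a F c b -> lascar_dist_le E a F n b c;
    (* (4) *)
    exists n : nat,
      forall (J : Type) (F : tdequiv M J) (b c : J -> M), small K J ->
        lascar_equiv K E a F b c <-> lascar_dist_le E a F n b c].
Proof.
have [_ hK hsat hhom] := hM; tfae.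
- exact: G_compact_type_definable.
- exact: type_definable_bounded.
- exact: bounded_uniform.
- exact: uniform_G_compact.
Qed.
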